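(* Let $\mu$ be a symmetric probability measure on $\mathbb R$ with unit variance, $L(x)=\log\int e^{xt}\,d\mu(t)$ and $\psi(x)=L(x)/x^2$ (with $\psi(0)=1/2$). Assume that $A:=2\sup_{x\in\mathbb R}\psi(x)<+\infty$, that $A>1$, that the limit $B:=2\lim_{|x|\to+\infty}\psi(x)\ge 0$ exists, and that $x\mapsto L(\sqrt{x})$ is Lipschitz on $[0,+\infty)$. Let $X_N$ be the Wigner matrix associated with $\mu$ and assume that for some $\kappa>0$, $\limsup_{N\to+\infty}\frac1N\log\mathbb P\big(d(\hat\mu_{X_N},\sigma)>N^{-\kappa}\big)=-\infty$. Then for any $0\le\theta\le\frac1{2\sqrt{A-1}}$, $$\underline F(\theta)=\overline F(\theta)=\theta^2.$$
   Context: Wigner matrix associated with $\mu$: $X_N$ is an $N\times N$ real symmetric random matrix with independent entries $(X_{ij})_{i\le j}$ such that $\sqrt N X_{ij}$ has law $\mu$ for $i<j$ and $\sqrt{N/2}\,X_{ii}$ has law $\mu$ for all $i$. $\hat\mu_{X_N}$ is the empirical distribution of its eigenvalues, $\sigma(dx)=\frac1{2\pi}\sqrt{4-x^2}\,\mathbf 1_{|x|\le2}dx$ is the semicircle law, and $d$ is a distance compatible with the weak topology. Annealed spherical integral: for $\theta\ge0$, $F_N(\theta)=\frac1N\log\mathbb E_{X_N}\mathbb E_e[\exp(N\theta\langle e,X_Ne\rangle)]$, where $e$ is uniform on $\mathbb S^{N-1}$ and independent of $X_N$; $\overline F(\theta)=\limsup_NF_N(\theta)$, $\underline F(\theta)=\liminf_NF_N(\theta)$.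 *)

(* Defs.v *)
From HB Require Import structures.
From mathcomp Require Import all_boot all_order all_algebra lra ring.
From mathcomp Require Import complex.
From mathcomp Require Import all_classical all_reals all_analysis measurable_realfun.

Set Implicit Arguments.
Unset Strict Implicit.
Unset Printing Implicit Defensive.

Import Order.TTheory GRing.Theory Num.Theory.
Import numFieldNormedType.Exports.

Local Open Scope classical_set_scope.
Local Open Scope ring_scope.

Section RandomVariables.
Context {R : realType}.
Local Notation RR := (measurableTypeR R).

Definition has_law {d} {T : measurableType d} (P : probability T R)
    (Y : T -> R) (mu : probability RR R) : Prop :=
  measurable_fun [set: T] (Y : T -> RR) /\
  forall A : set RR, measurable A -> pushforward P (Y : T -> RR) A = mu A.

(* Mutual independence of the subfamily (Y i) for i in D. *)
Definition mutually_independent {d} {T : measurableType d}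
    (P : probability T R) (I : finType) (D : {set I}) (Y : I -> T -> R) : Prop :=
  forall (J : {set I}) (A : I -> set RR), J \subset D ->
    (forall i, measurable (A i)) ->
    P (\bigcap_(i in [set` J]) (Y i @^-1` A i)) =
    (\big[*%E/1%E]_(i in J) P (Y i @^-1` A i))%E.

Definition symmetric_law (mu : probability RR R) : Prop :=
  forall A : set RR, measurable A -> pushforward mu (-%R : RR -> RR) A = mu A.

End RandomVariables.

Section LogLaplace.
Context {R : realType} (mu : probability (measurableTypeR R) R).
Local Open Scope ereal_scope.

(* Extended-real valued, so that an infinite Laplace transform gives +oo. *)
Definition logmgf (x : R) : \bar R := lne ('M_mu idfun x).

Definition psi (x : R) : \bar R :=
  if x == 0%R then (2^-1)%:E else logmgf x * ((x ^+ 2)^-1)%:E.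

(* The constant usually called A, a priori in \bar R. *)
Definition subgauss_const : \bar R := 2%:E * ereal_sup (range psi).

End LogLaplace.

Section WeakTopology.
Context {R : realType}.
Local Notation PR := (probability (measurableTypeR R) R).

Definition bounded_continuous : Type :=
  {f : R -> R | continuous f /\ bounded_fun f}.

(* The weak topology on probability measures is the initial topology of the
   map sending m to the family of its integrals of bounded continuous
   functions. *)
Definition integrate_bc (m : PR) : {ptws bounded_continuous -> R} :=
  fun f => (\int[m]_x (sval f x))%R.

(* A distance whose topology is the weak one. In wdist_eq0 measures are compared
   on measurable sets only: two measures in the library may agree on all Borel
   sets without being Leibniz-equal, because they are total functions on
   [set R], and no weakly compatible dist could separate them. *)
Record weakly_compatible_distance (dist : PR -> PR -> R) : Prop := {
  wdist_ge0 : forall m1 m2, 0 <= dist m1 m2 ;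
  wdist_eq0 : forall m1 m2, dist m1 m2 = 0 <->
    forall A, measurable A -> m1 A = m2 A ;
  wdist_sym : forall m1 m2, dist m1 m2 = dist m2 m1 ;
  wdist_triangle : forall m1 m2 m3, dist m1 m3 <= dist m1 m2 + dist m2 m3 ;
  wdist_nbhs : forall (m : PR) (U : set PR),
    nbhs (m : initial_topology integrate_bc) U <->
    exists2 e : R, 0 < e & [set m' | dist m m' < e] `<=` U }.

End WeakTopology.

Lemma char_poly_simmx (F : fieldType) n (P D : 'M[F]_n) : P \in unitmx ->
  char_poly (invmx P *m D *m P) = char_poly D.
Proof.
move=> Pu; rewrite /char_poly.
pose p (M : 'M[F]_n) : 'M[{poly F}]_n := map_mx (@polyC F) M.
have PV : p (invmx P) *m p P = 1%:M by rewrite /p -map_mxM/= mulVmx// map_mx1.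
have -> : char_poly_mx (invmx P *m D *m P) = p (invmx P) *m char_poly_mx D *m p P.
  rewrite /char_poly_mx mulmxBr mulmxBl mul_mx_scalar -scalemxAl PV scalemx1.
  by rewrite /p !map_mxM.
by rewrite !det_mulmx mulrAC -det_mulmx PV det1 mul1r.
Qed.

Section Spectrum.
Context {R : realType}.
Local Open Scope complex_scope.
Local Open Scope sesquilinear_scope.

Lemma char_poly_sym_split (n : nat) (A : 'M[R]_n) : A^T = A ->
  exists s : n.-tuple R, char_poly A = \prod_(x <- s) ('X - x%:P).
Proof.
move=> AT; pose f := real_complex R.
pose Ac : 'M[R[i]]_n := map_mx f A.
have Areal : Ac \is a realmx.
  by apply/mxOverP => i j; rewrite !mxE complex_real.
have Aherm : Ac \is hermsymmx.
  apply: realsym_hermsym => //.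
  apply/is_hermitianmxP; rewrite expr0 scale1r.
  by apply/matrixP => i j; rewrite !mxE -[in RHS]AT mxE.
have dreal := hermitian_spectral_diag_real Aherm.
have /orthomx_spectralP Aeq := hermitian_normalmx Aherm.
pose s := [tuple complex.Re (spectral_diag Ac 0 i) | i < n].
exists s; apply: (map_poly_inj f); rewrite map_char_poly -/Ac.
rewrite {1}Aeq char_poly_simmx ?spectral_unit// char_poly_trig ?diag_mx_is_trig//.
rewrite rmorph_prod/= big_map big_enum; apply: eq_bigr => i _.
rewrite rmorphB/= map_polyX map_polyC/= mxE eqxx mulr1n.
by move/mxOverP : dreal => /(_ 0 i)/RRe_real <-.
Qed.

(* The spectrum with multiplicity, as a tuple whose (irrelevant) order is
   chosen arbitrarily; the default value only occurs when the characteristic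
   polynomial does not split over R, hence never for symmetric matrices. *)
Definition eigenvalues (n : nat) (A : 'M[R]_n) : n.-tuple R :=
  xget [tuple of nseq n 0]
    [set s : n.-tuple R | char_poly A = \prod_(x <- s) ('X - x%:P)].

Lemma eigenvaluesP (n : nat) (A : 'M[R]_n) : A^T = A ->
  char_poly A = \prod_(x <- eigenvalues A) ('X - x%:P).
Proof.
move=> /char_poly_sym_split[s As]; rewrite /eigenvalues.
by case: xgetP => [t _ //|/(_ s)].
Qed.

Definition empirical (n : nat) (s : n.+1.-tuple R) :
    set (measurableTypeR R) -> \bar R :=
  mscale (n.+1%:R^-1)%:nng
    (msum (fun k => dirac (nth 0 s k : measurableTypeR R)) n.+1).

HB.instance Definition _ n s := Measure.on (@empirical n s).

Let empirical_setT n s : @empirical n s setT = 1%E.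
Proof.
rewrite /empirical /mscale/= /msum.
rewrite (eq_bigr (fun=> 1%:E)) => [|k _]; last exact: diracT.
rewrite sumEFin -EFinM; congr EFin.
by rewrite sumr_const card_ord mulVf.
Qed.

HB.instance Definition _ n s :=
  Measure_isProbability.Build _ _ _ (@empirical n s) (empirical_setT s).

Definition esd (n : nat) (A : 'M[R]_n.+1) : probability (measurableTypeR R) R :=
  empirical (eigenvalues A).

End Spectrum.

Section Semicircle.
Context {R : realType}.
Local Notation mu := (@lebesgue_measure R).

Definition semicircle_pdf (x : R) : R :=
  (2 * pi)^-1 * Num.sqrt (4 - x ^+ 2) * \1_(`[(-2)%R, 2%R]) x.

Lemma semicircle_pdf_ge0 x : 0 <= semicircle_pdf x.
Proof.
by rewrite /semicircle_pdf !mulr_ge0// ?sqrtr_ge0// invr_ge0 mulr_ge0// pi_ge0.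
Qed.

Lemma continuous_sqrt4 : continuous (fun x : R => Num.sqrt (4 - x ^+ 2)).
Proof.
move=> x; apply: continuous_comp; last exact: sqrt_continuous.
by apply: cvgB; [exact: cvg_cst|exact: exprn_continuous].
Qed.

Lemma measurable_semicircle_pdf :
  measurable_fun [set: measurableTypeR R] (semicircle_pdf : _ -> measurableTypeR R).
Proof.
apply: measurable_funM.
  apply: measurable_funM => //.
  exact: continuous_measurable_fun continuous_sqrt4.
by apply: measurable_indic; exact: measurable_itv.
Qed.

Lemma semicircle_subst (t : R) : t \in `[(- (pi / 2)), pi / 2] ->
  Num.sqrt (4 - (2 * sin t) ^+ 2) * (2 * cos t) = 4 * cos t ^+ 2.
Proof.
move=> tI; have -> : 4 - (2 * sin t) ^+ 2 = (2 * cos t) ^+ 2.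
  by rewrite [in RHS]exprMn cos2sin2; ring.
rewrite sqrtr_sqr ger0_norm; first by ring.
by rewrite mulr_ge0// cos_ge0_pihalf//; move: tI; rewrite in_itv.
Qed.

Lemma integral_semicircle_sqrt :
  (\int[mu]_(x in `[(-2)%R, 2%R]) (Num.sqrt (4 - x ^+ 2))%:E = (2 * pi)%:E)%E.
Proof.
pose F (t : R) : R := 2 * sin t.
have dF (t : R) : is_derive t (1 : R) F (2 * cos t) by exact: is_derive_eq.
have F'E : derive1 F = (fun t => 2 * cos t).
  by apply/funext => t; rewrite derive1E (@derive_val _ _ _ _ _ _ _ (dF t)).
have cF : continuous F.
  by move=> t; apply: cvgM; [exact: cvg_cst|exact: continuous_sin].
have cF' : continuous (fun t : R => 2 * cos t).
  by move=> t; apply: cvgM; [exact: cvg_cst|exact: continuous_cos].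
have pi0 : - (pi / 2) < pi / 2 :> R by have := pi_gt0 R; lra.
have Fa : F (- (pi / 2)) = -2 by rewrite /F sinN sin_pihalf mulrN1.
have Fb : F (pi / 2) = 2 by rewrite /F sin_pihalf mulr1.
have := @integration_by_substitution_increasing R F
  (fun x => Num.sqrt (4 - x ^+ 2)) _ _ (ltW pi0).
rewrite Fa Fb => ->; last 6 first.
- by move=> x y xI yI xy; rewrite /F ltr_pM2l// ltr_sin.
- by rewrite F'E => x _; exact: cF'.
- by rewrite F'E; apply: cvgP; apply: cvg_at_right_filter; exact: cF'.
- by rewrite F'E; apply: cvgP; apply: cvg_at_left_filter; exact: cF'.
- split.
  + by move=> x _; exact: (@ex_derive _ _ _ _ _ _ _ (dF x)).
  + by apply: cvg_at_right_filter; exact: cF.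
  + by apply: cvg_at_left_filter; exact: cF.
- by apply: continuous_subspaceT => x; exact: continuous_sqrt4.
pose G (t : R) : R := 2 * t + 2 * (sin t * cos t).
have dG (t : R) : is_derive t (1 : R) G (4 * cos t ^+ 2).
  apply: is_derive_eq.
  rewrite /GRing.scale/=.
  by have := sin2cos2 t; rewrite !expr2; lra.
have G'E t : derive1 G t = 4 * cos t ^+ 2.
  by rewrite derive1E (@derive_val _ _ _ _ _ _ _ (dG t)).
have cG : continuous G.
  move=> t; apply: differentiable_continuous; apply/derivable1_diffP.
  exact: (@ex_derive _ _ _ _ _ _ _ (dG t)).
transitivity (\int[mu]_(t in `[(- (pi / 2))%R, (pi / 2)%R])
    (4 * cos t ^+ 2)%:E)%E.
  apply: eq_integral => t; rewrite inE/= => tI; congr EFin.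
  by rewrite F'E fctE /F /= semicircle_subst.
rewrite (@continuous_FTC2 R _ G)//.
- rewrite -EFinB /G sinN cosN sin_pihalf cos_pihalf; congr EFin.
  by field.
- apply: continuous_subspaceT => t; apply: cvgM; first exact: cvg_cst.
  by apply: cvgM; exact: continuous_cos.
- split.
  + by move=> x _; exact: (@ex_derive _ _ _ _ _ _ _ (dG x)).
  + by apply: cvg_at_right_filter; exact: cG.
  + by apply: cvg_at_left_filter; exact: cG.
Qed.

Lemma integral_semicircle_pdf : (\int[mu]_x (semicircle_pdf x)%:E = 1)%E.
Proof.
pose g : R -> \bar R :=
  (EFin \o (fun x => Num.sqrt (4 - x ^+ 2))) \_ `[(-2)%R, 2%R].
transitivity (\int[mu]_x (((2 * pi)^-1)%:E * g x))%E.
  apply: eq_integral => x _.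
  by rewrite /g epatch_indic /= /semicircle_pdf -!EFinM mulrA.
rewrite ge0_integralZl//=.
- rewrite /g -integral_mkcond integral_semicircle_sqrt -EFinM mulVf//.
  by rewrite gt_eqF// mulr_gt0// pi_gt0.
- apply/(measurable_restrictT _ _).1; first exact: measurable_itv.
  apply/measurable_EFinP; apply: (@measurable_funTS _ _ R R).
  exact: continuous_measurable_fun continuous_sqrt4.
- by move=> x _; rewrite /g patchE; case: ifP => // _; rewrite lee_fin sqrtr_ge0.
- by rewrite lee_fin invr_ge0 mulr_ge0// pi_ge0.
Qed.

Definition semicircle (A : set (measurableTypeR R)) : \bar R :=
  (\int[mu]_(x in A) (semicircle_pdf x)%:E)%E.

Let semicircle0 : semicircle set0 = 0%E.
Proof. by rewrite /semicircle integral_set0. Qed.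

Let semicircle_ge0 A : (0 <= semicircle A)%E.
Proof. by apply: integral_ge0 => x _; rewrite lee_fin semicircle_pdf_ge0. Qed.

Let semicircle_sigma_additive : semi_sigma_additive semicircle.
Proof.
move=> /= F mF tF mUF; rewrite /semicircle; apply: cvg_toP.
  apply: ereal_nondecreasing_is_cvgn => m n mn.
  apply: lee_sum_nneg_natr => // k _ _; exact: semicircle_ge0.
rewrite ge0_integral_bigcup//=.
- by apply/measurable_funTS/measurableT_comp => //; exact: measurable_semicircle_pdf.
- by move=> x _; rewrite lee_fin semicircle_pdf_ge0.
Qed.

HB.instance Definition _ := isMeasure.Build _ _ _
  semicircle semicircle0 semicircle_ge0 semicircle_sigma_additive.

HB.instance Definition _ :=
  Measure_isProbability.Build _ _ _ semicircle integral_semicircle_pdf.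

End Semicircle.

Section WignerModel.
Context {R : realType}.

(* Diagonal entries have variance 2 / n and off-diagonal ones 1 / n. *)
Record wigner (mu : probability (measurableTypeR R) R) {n : nat} {d}
    {T : measurableType d} (P : probability T R) (X : T -> 'M[R]_n) : Prop := {
  wigner_sym : forall w, (X w)^T = X w ;
  wigner_meas : forall i j,
    measurable_fun [set: T] ((fun w => X w i j) : T -> measurableTypeR R) ;
  wigner_indep : mutually_independent P
    [set p : 'I_n * 'I_n | (p.1 <= p.2)%N]%SET (fun p w => X w p.1 p.2) ;
  wigner_offdiag : forall i j : 'I_n, (i < j)%N ->
    has_law P (fun w => Num.sqrt n%:R * X w i j) mu ;
  wigner_diag : forall i : 'I_n,
    has_law P (fun w => Num.sqrt (n%:R / 2) * X w i i) mu }.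

(* 'rV[R]_n with its Borel sigma-algebra. *)
Definition borel_rV (n : nat) := g_sigma_algebraType (@open 'rV[R]_n).

Definition unit_sphere (n : nat) : set 'rV[R]_n :=
  [set e | (e *m e^T) 0 0 = 1].

(* The uniform law on the sphere: the (unique) probability measure carried by the
   sphere that is invariant under the orthogonal group. *)
Definition uniform_on_sphere (n : nat) (Q : probability (borel_rV n) R) : Prop :=
  Q (@unit_sphere n) = 1%E /\
  forall O : 'M[R]_n, O *m O^T = 1%:M ->
    forall A : set (borel_rV n), measurable A ->
      pushforward Q ((fun e : 'rV[R]_n => e *m O) : borel_rV n -> borel_rV n) A =
      Q A.

(* n^-1 log E_X E_e [exp (n theta <e, X e>)]; the independence of X and e is
   that of the two coordinates of the product space of P and Q. *)
Definition annealed_F {n : nat} {d} {T : measurableType d}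
    (P : probability T R) (X : T -> 'M[R]_n) (Q : probability (borel_rV n) R)
    (theta : R) : \bar R :=
  ((n%:R^-1)%:E * lne (\int[P]_w \int[Q]_e
     (expR (n%:R * theta * ((e : 'rV[R]_n) *m X w *m e^T) 0 0))%:E))%E.

End WignerModel.

(* Main.v *)
Require Import Defs.
From HB Require Import structures.
From mathcomp Require Import all_boot all_order all_algebra lra ring.
From mathcomp Require Import all_classical all_reals all_analysis measurable_realfun.

Set Implicit Arguments.
Unset Strict Implicit.
Unset Printing Implicit Defensive.

Import Order.TTheory GRing.Theory Num.Theory.
Import numFieldNormedType.Exports.

Local Open Scope classical_set_scope.
Local Open Scope ring_scope.

(* Averaging over X_N first turns the annealed integral into
   E_e prod_{i <= j} M(c_ij), where M is the Laplace transform of mu and the c_ij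
   are proportional to sqrt N e_i e_j, with sum_{i <= j} c_ij^2 / 2 = N theta^2.

   Lower bound: M(x) >= exp (x^2/2 - x^4/4), and the quartic correction has bounded
   expectation under the uniform law, so convexity of exp loses only O(1).

   Upper bound: call a coordinate large when e_i^2 > t, with t slightly below
   N^(-1/2), and let s be the mass of the large coordinates.  Pairs of small
   coordinates have c_ij -> 0, hence contribute (1 + o(1)) c_ij^2 / 2; the others
   contribute at most A c_ij^2 / 2.  The exponent is thus at most
   N theta^2 (1 + o(1)) + 2 N theta^2 (A - 1) s, and the hypothesis on theta makes
   the last term at most N s / 2.  This is exactly critical, E exp (N s / 2) being
   still exp (o(N)): there are at most 1 / t = o(N / log N) large coordinates,
   exp (N e_i^2 / 2) is dominated by a polynomial number of exponentials
   exp (g sqrt N e_i - g^2 / 2), and E exp <v, e> <= exp (|v|^2 / (2 N)).  The last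
   bound holds because v may be rotated to a multiple of any sign vector;
   averaging over the signs leaves a product of hyperbolic cosines, and
   cosh x <= exp (x^2 / 2). *)

(** * Elementary bounds on the hyperbolic cosine *)

Section HyperbolicCosine.
Context {R : realType}.
Implicit Types x y z : R.

Definition coshR x : R := (expR x + expR (- x)) / 2.

Lemma coshR_gt0 x : 0 < coshR x.
Proof. by rewrite divr_gt0// addr_gt0// expR_gt0. Qed.

(** This is cosh x - 1 = 2 sinh^2 (x / 2), with sinh left unnormalized; the quadratic bounds on
    [coshR] from both sides are read off from it. *)
Lemma coshR_half x : coshR x - 1 = (expR (x / 2) - expR (- (x / 2))) ^+ 2 / 2.
Proof.
have xE : x = x / 2 + x / 2 by lra.
have e1 := expRxMexpNx_1 (x / 2).
rewrite /coshR {1 2}xE opprD !expRD.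
move: (expR _) (expR _) e1 => a b e1.
by apply/eqP; rewrite -subr_eq0; apply/eqP; transitivity (a * b - 1); [field|lra].
Qed.

(** Factor e^(-z) = e^(-2z) e^z and use 1 - 2z <= e^(-2z). *)
Lemma expR_sub_expRN_le z : 0 <= z -> expR z - expR (- z) <= 2 * z * expR z.
Proof.
move=> z0.
have -> : expR (- z) = expR (- (2 * z)) * expR z by rewrite -expRD; congr expR; lra.
by have := expR_ge1Dx (- (2 * z)); have := expR_gt0 z; nra.
Qed.

Lemma expR_sub_expRN_ge z : 0 <= z -> 2 * z <= expR z - expR (- z).
Proof.
move=> z0.
pose f (t : R) := expR t - expR (- t) - 2 * t.
have df (t : R) : is_derive t (1 : R) f (expR t + expR (- t) - 2).
  by apply: is_derive_eq; rewrite /GRing.scale/=; ring.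
have cf : {within `[0, z], continuous f}.
  apply: continuous_subspaceT => x; apply: differentiable_continuous.
  by apply/derivable1_diffP; apply: (@ex_derive _ _ _ _ _ _ _ (df x)).
have [c _] := MVT_segment z0 (fun x _ => df x) cf.
rewrite /f oppr0 expR0 mulr0 subr0.
have := expRxMexpNx_1 c; have := expR_gt0 c; have := expR_gt0 (- c).
move: (expR c) (expR (- c)) => a b a0 b0 ab.
(* The derivative of [f] is nonnegative: since a b = 1, a (a + b - 2) = (a - 1)^2. *)
have ab2 : 0 <= a + b - 2.
  by rewrite -(pmulr_rge0 _ a0); have := sqr_ge0 (a - 1); nra.
have : 0 <= (a + b - 2) * z by rewrite mulr_ge0.
by move: (expR z) (expR (- z)) => u v; nra.
Qed.

Lemma expR_sub_expRN_sqr z :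
  4 * z ^+ 2 <= (expR z - expR (- z)) ^+ 2 <= 4 * z ^+ 2 * expR `|z| ^+ 2.
Proof.
have -> : (expR z - expR (- z)) ^+ 2 = (expR `|z| - expR (- `|z|)) ^+ 2.
  by case: (ger0P z) => // _; rewrite opprK -sqrrN opprB.
rewrite -[z ^+ 2]real_normK ?num_real//.
have dt := expR_sub_expRN_ge (normr_ge0 z).
have da := expR_sub_expRN_le (normr_ge0 z).
have t0 := normr_ge0 z; have a0 := expR_gt0 `|z|.
have -> : 4 * `|z| ^+ 2 * expR `|z| ^+ 2 = (2 * `|z| * expR `|z|) ^+ 2 by ring.
have -> : 4 * `|z| ^+ 2 = (2 * `|z|) ^+ 2 by ring.
have d0 := le_trans (mulr_ge0 (ler0n R 2) t0) dt.
by rewrite !lerXn2r// ?nnegrE// !mulr_ge0// ltW.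
Qed.

Lemma coshR_ge x : 1 + x ^+ 2 / 2 <= coshR x.
Proof.
have /andP[h _] := expR_sub_expRN_sqr (x / 2).
have := coshR_half x; move: h; rewrite expr_div_n.
have -> : 2 ^+ 2 = 4 :> R by ring.
by lra.
Qed.

Lemma coshR_le x : coshR x <= 1 + x ^+ 2 / 2 * expR `|x|.
Proof.
have /andP[_ h] := expR_sub_expRN_sqr (x / 2).
have := coshR_half x; move: h.
rewrite -expRM_natr normrM [ `|_^-1|]gtr0_norm// divfK// expr_div_n.
have -> : 2 ^+ 2 = 4 :> R by ring.
by lra.
Qed.

(** With u = y / (1 + y), the inequality 1 - u <= exp (- u) reads exp u <= 1 + y, and y - y^2 <=
    u. *)
Lemma expR_subr_sqr y : 0 <= y -> expR (y - y ^+ 2) <= 1 + y.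
Proof.
move=> y0; have y1 : 0 < 1 + y by lra.
have h : y - y ^+ 2 <= y / (1 + y) by rewrite ler_pdivlMr//; nra.
apply: (@le_trans _ _ (expR (y / (1 + y)))); first by rewrite ler_expR.
have := expR_ge1Dx (- (y / (1 + y))).
have -> : 1 - y / (1 + y) = (1 + y)^-1 by field; rewrite gt_eqF.
by rewrite expRN lef_pV2// posrE expR_gt0.
Qed.

(* Since [coshR x = 2 c ^+ 2 - 1] with [c = coshR (x / 2)]. *)
Lemma coshR_le_half x : coshR x <= coshR (x / 2) ^+ 4.
Proof.
have -> : coshR x = 2 * coshR (x / 2) ^+ 2 - 1.
  have := coshR_half x; have e1 := expRxMexpNx_1 (x / 2).
  move: (coshR x) => c; rewrite /coshR.
  move: (expR _) (expR _) e1 => a b e1 ch.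
  have -> : c = 1 + (a - b) ^+ 2 / 2 by lra.
  by apply/eqP; rewrite -subr_eq0; apply/eqP; transitivity (2 * (1 - a * b)); [field|lra].
by move: (coshR _) => c; have := sqr_ge0 (c ^+ 2 - 1); nra.
Qed.

(** Iterating the duplication bound m times and then applying the crude [coshR_le] gives exp (x^2 /
    2 * exp (|x| / 2^m)); the spurious inner factor tends to 1 as m grows. *)
Lemma coshR_le_expR x : coshR x <= expR (x ^+ 2 / 2).
Proof.
have cosh2n m : coshR x <= coshR (x / 2 ^+ m) ^+ (4 ^ m)%N.
  elim: m => [|m ih]; first by rewrite expr0 divr1 expn0 expr1.
  apply: (le_trans ih); rewrite expnS exprM.
  rewrite lerXn2r// ?nnegrE ?exprn_ge0// ?(ltW (coshR_gt0 _))//.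
  by have := coshR_le_half (x / 2 ^+ m); rewrite -mulrA -invfM -exprSr.
have le_m m : coshR x <= expR (x ^+ 2 / 2 * expR (`|x| / 2 ^+ m)).
  apply: (le_trans (cosh2n m)); set y := x / 2 ^+ m.
  apply: (@le_trans _ _ (expR (y ^+ 2 / 2 * expR `|y|) ^+ (4 ^ m)%N)).
    rewrite lerXn2r// ?nnegrE ?expR_ge0 ?(ltW (coshR_gt0 _))//.
    exact: (le_trans (coshR_le _) (expR_ge1Dx _)).
  rewrite -expRM_natr ler_expR /y natrX normrM normfV.
  rewrite [ `|2 ^+ m|]ger0_norm ?exprn_ge0// exprMn exprVn.
  have -> : 4%:R = 2 ^+ 2 :> R by ring.
  rewrite -!exprM mulnC; set z := 2 ^+ _; have z0 : z != 0 by rewrite expf_neq0.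
  by rewrite le_eqVlt; apply/orP; left; apply/eqP; field.
have [->|x0] := eqVneq x 0; first by rewrite /coshR oppr0 expr0n mul0r expR0; lra.
have x2 : 0 < x ^+ 2 / 2 by rewrite divr_gt0// exprn_even_gt0.
rewrite leNgt; apply/negP => lt_c.
(* The limit in m is taken by contradiction. The excess ratio [r] > 1 would satisfy ln r <= |x| /
   2^m for every m, which fails once m > |x| / ln r because m < 2^m. *)
pose r := ln (coshR x) / (x ^+ 2 / 2).
have r1 : 1 < r.
  rewrite ltr_pdivlMr// mul1r -[ltLHS]expRK ltr_ln ?posrE ?expR_gt0//.
  exact: coshR_gt0.
have lnr m : ln r <= `|x| / 2 ^+ m.
  rewrite -[leRHS]expRK ler_ln ?posrE ?expR_gt0 ?(lt_trans _ r1)//.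
  rewrite ler_pdivrMr// mulrC -ler_expR lnK ?posrE ?coshR_gt0//.
have lr0 : 0 < ln r by rewrite ln_gt0.
pose m := Num.bound (`|x| / ln r).
have xm : `|x| / ln r < m%:R by apply: archi_boundP; rewrite divr_ge0// ltW.
have := lnr m.
rewrite ler_pdivlMr ?exprn_gt0//; apply/negP; rewrite -ltNge.
rewrite ltr_pdivrMr// in xm; apply: (lt_le_trans xm).
by rewrite mulrC ler_pM2l// -natrX ler_nat ltnW// ltn_expl.
Qed.

End HyperbolicCosine.

(** * From independence of events to expectations of products *)

Section LayerCake.
Context {R : realType} {d} {T : measurableType d} (P : probability T R).
Local Notation leb := (@lebesgue_measure R).

Let slice (Z F : T -> R) (p : T * R) : \bar R :=
  (Z p.1 * (0 <= p.2 < F p.1)%R%:R)%:E.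

Lemma measurable_natmul_bool d' (T' : measurableType d') (b : T' -> bool) :
  measurable_fun [set: T'] b -> measurable_fun [set: T'] (fun x => (b x)%:R : R).
Proof.
move=> mb.
have -> : (fun x => (b x)%:R : R) = (fun x => if b x then 1 else 0).
  by apply/funext => x; case: (b x).
by apply: measurable_fun_ifT => //; exact: measurable_cst.
Qed.

Let measurable_slice (Z F : T -> R) : measurable_fun [set: T] Z -> measurable_fun [set: T] F ->
  measurable_fun [set: T * R] (slice Z F).
Proof.
move=> mZ mF; apply/measurable_EFinP; apply: measurable_funM.
  exact: measurableT_comp.
apply: measurable_natmul_bool; apply: measurable_and.
  by apply: measurable_fun_ler => //; exact: measurable_cst.
by apply: measurable_fun_ltr => //; exact: measurableT_comp.
Qed.

(** F(w) is the length of the set of s with 0 <= s < F(w); Tonelli exchanges s and w. *)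
Let layer_cake (Z F : T -> R) : measurable_fun [set: T] Z -> measurable_fun [set: T] F ->
  (forall w, 0 <= Z w) -> (forall w, 0 <= F w) ->
  (\int[P]_w (Z w * F w)%:E = \int[leb]_s \int[P]_w slice Z F (w, s))%E.
Proof.
move=> mZ mF Z0 F0; rewrite -fubini_tonelli//; last 2 first.
- exact: measurable_slice.
- by move=> p; rewrite lee_fin mulr_ge0.
apply: eq_integral => w _; rewrite /slice/=.
under eq_integral do rewrite EFinM.
rewrite ge0_integralZl//=; last 2 first.
- suff : measurable_fun [set: R] (fun s : R => (0 <= s < F w)%R%:R : R).
    by move=> ?; exact/measurable_EFinP.
  apply: measurable_natmul_bool; apply: measurable_and.
    by apply: measurable_fun_ler.
  by apply: measurable_fun_ltr.
- by rewrite lee_fin.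
rewrite EFinM; congr (_ * _)%E.
transitivity (\int[leb]_s (\1_`[0, F w[ s)%:E)%E; last first.
  apply: eq_integral => s _; rewrite indicE; congr (_%:R%:E).
  by rewrite mem_setE/= in_itv.
rewrite integral_indic// setIT.
transitivity ((if 0 < F w then F w - 0 else 0)%:E); last first.
  by rewrite -[RHS]/(lebesgue_measure _) lebesgue_measure_itv/= lte_fin; case: ifP.
by case: ltgtP (F0 w) => // [_ _|<- _]; rewrite ?subr0.
Qed.

(** Reduces a factorization for [F] to one for its superlevel events: both sides are expanded by
    [layer_cake], with weight 1 on the right, and compared level by level. *)
Lemma integralM_of_superlevel (Z F : T -> R) (z : R) :
  measurable_fun [set: T] Z -> measurable_fun [set: T] F ->
  (forall w, 0 <= Z w) -> (forall w, 0 <= F w) -> 0 <= z ->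
  (forall s : R, (0 <= s)%R ->
    \int[P]_w (Z w * (s < F w)%R%:R)%:E = z%:E * P [set w | (s < F w)%R])%E ->
  (\int[P]_w (Z w * F w)%:E = z%:E * \int[P]_w (F w)%:E)%E.
Proof.
move=> mZ mF Z0 F0 z0 ZF.
pose one (w : T) : R := 1.
have mone : measurable_fun [set: T] one by exact: measurable_cst.
rewrite layer_cake//.
have -> : (\int[P]_w (F w)%:E = \int[P]_w (one w * F w)%:E)%E.
  by apply: eq_integral => w _; rewrite mul1r.
have sl0 p : (0 <= slice one F p)%E by rewrite lee_fin mulr_ge0.
have msl : measurable_fun [set: R] (fun s => \int[P]_w slice one F (w, s))%E.
  exact: (measurable_fun_fubini_tonelli_G _ (measurable_slice mone mF) sl0).
rewrite layer_cake// -ge0_integralZl//; last first.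
  by move=> s _; apply: integral_ge0 => w _; exact: sl0.
apply: eq_integral => s _; rewrite /slice/=.
have [s0|s0] /= := leP 0 s; last first.
  under eq_integral do rewrite mulr0.
  under [in RHS]eq_integral do rewrite mulr0.
  by rewrite integral0 mule0.
rewrite ZF//; congr (_ * _)%E.
transitivity (\int[P]_w (\1_[set w | s < F w] w)%:E)%E; last first.
  by apply: eq_integral => w _; rewrite indicE mul1r mem_setE.
rewrite integral_indic ?setIT//.
rewrite -[X in measurable X]setTI.
by apply: (measurable_fun_ltr _ _ measurableT (Y := [set true])).
Qed.

End LayerCake.

Section Independence.
Context {R : realType} {d} {T : measurableType d} (P : probability T R).
Context (I : finType) (D : {set I}) (Y : I -> T -> R) (f : I -> R -> R) (m : I -> R).
Hypothesis Y_indep : mutually_independent P D Y.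
Hypothesis mY : forall i, measurable_fun [set: T] (Y i).
Hypothesis mf : forall i, measurable_fun [set: R] (f i).
Hypothesis f_ge0 : forall i x, 0 <= f i x.
Hypothesis f_int : forall i, i \in D -> (\int[P]_w (f i (Y i w))%:E = (m i)%:E)%E.

Let pr (i : I) (A : I -> set (measurableTypeR R)) : R := fine (P (Y i @^-1` A i)).

Let mYA i A : measurable A -> measurable (Y i @^-1` A).
Proof. by move=> mA; rewrite -[X in measurable X]setTI; exact: mY. Qed.

(** Indices move from [s] to [J] one at a time: by [integralM_of_superlevel], f_i may be replaced by
    the indicator of one of its superlevel sets, so that i joins [J]. When [s] is empty only events
    are left, and the claim is the definition of independence. *)
Let indep_seq (s : seq I) : uniq s -> forall (J : {set I}) A, J \subset D ->
  (forall i, measurable (A i)) -> (forall i, i \in s -> i \in D /\ i \notin J) ->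
  (\int[P]_w ((\prod_(i <- s) f i (Y i w)) * \prod_(i in J) \1_(A i) (Y i w))%:E =
   ((\prod_(i <- s) m i) * \prod_(i in J) pr i A)%:E)%E.
Proof.
elim: s => [_|i s ih /= /andP[nis us]] J A JD mA sD.
  rewrite big_nil; under eq_integral do rewrite big_nil mul1r.
  rewrite mul1r.
  transitivity (\int[P]_w (\1_(\bigcap_(i in [set` J]) (Y i @^-1` A i)) w)%:E)%E.
    apply: eq_integral => w _; congr EFin; rewrite indicE.
    have [wJ|wJ] := boolP (w \in _).
      rewrite big1// => i iJ; rewrite indicE mem_set//.
      by move: wJ; rewrite inE => /(_ i iJ).
    move: wJ; rewrite notin_setE => /existsNP[j /not_implyP[jJ njA]].
    by rewrite (bigD1 j)//= indicE memNset ?mul0r.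
  rewrite integral_indic ?setIT//; last first.
    apply: fin_bigcap_measurable => //.
    by move=> i _; exact: mYA.
  rewrite -[LHS]/(P _) (Y_indep JD mA) -prodEFin; apply: eq_bigr => i _.
  by rewrite /pr fineK// fin_num_measure//; exact: mYA.
have [iD iJ] : i \in D /\ i \notin J by apply: sD; rewrite mem_head.
have sD' j : j \in s -> j \in D /\ j \notin J.
  by move=> js; apply: sD; rewrite inE js orbT.
pose Z w := (\prod_(j <- s) f j (Y j w)) * \prod_(j in J) \1_(A j) (Y j w).
have mZ : measurable_fun [set: T] Z.
  apply: measurable_funM; first by apply: measurable_prod => j _; exact: measurableT_comp.
  under eq_fun do rewrite -big_enum/=.
  apply: measurable_prod => j _; exact: measurableT_comp.
have Z0 w : 0 <= Z w.
  by rewrite mulr_ge0// prodr_ge0// => j _; rewrite indicE.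
have m0 : 0 <= \prod_(j <- s) m j.
  rewrite big_seq; apply: prodr_ge0 => j /sD'[jD _].
  by rewrite -lee_fin -f_int// integral_ge0// => w _; rewrite lee_fin.
have pr0 j A' : 0 <= pr j A' by rewrite fine_ge0.
under eq_integral do rewrite big_cons -mulrA mulrC -/(Z _).
rewrite (@integralM_of_superlevel _ _ _ _ Z (f i \o Y i)
  ((\prod_(j <- s) m j) * \prod_(j in J) pr j A)) //=.
- by rewrite f_int// -EFinM big_cons -mulrA mulrC.
- exact: measurableT_comp.
- by rewrite mulr_ge0// prodr_ge0.
move=> t t0.
pose A' j := if j == i then [set x | t < f i x] else A j.
have mA' j : measurable (A' j).
  rewrite /A'; case: eqP => // _; rewrite -[X in measurable X]setTI.
  by apply: (measurable_fun_ltr _ _ measurableT (Y := [set true])).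
have A'J j : j \in J -> A' j = A j.
  by rewrite /A'; case: eqP => // -> iJ'; rewrite iJ' in iJ.
have := ih us (i |: J) A' _ mA' _.
rewrite finset.subUset finset.sub1set iD JD => /(_ isT).
have -> : (\prod_(j in i |: J) pr j A' = fine (P [set w | t < f i (Y i w)]) *
    \prod_(j in J) pr j A)%R.
  rewrite big_setU1//=; congr (_ * _); first by rewrite /pr /A' eqxx.
  by apply: eq_bigr => j jJ; rewrite /pr A'J.
move=> ih'; rewrite -[P [set _ | _]]fineK; last first.
  rewrite fin_num_measure//; have := @mYA i (A' i) (mA' i).
  by rewrite /A' eqxx.
rewrite -EFinM -mulrA [_ * fine _]mulrC -ih'.
  apply: eq_integral => w _; rewrite -mulrA; congr (_ * _)%:E.
  rewrite big_setU1//= mulrC; congr (_ * _); first by rewrite /A' eqxx indicE mem_setE.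
  by apply: eq_bigr => j jJ; rewrite A'J.
move=> j js; have [jD jJ] := sD' j js; split => //.
by rewrite !inE negb_or jJ andbT; apply: contraNneq nis => <-.
Qed.

Lemma integral_prod_independent :
  (\int[P]_w (\prod_(i in D) f i (Y i w))%:E = (\prod_(i in D) m i)%:E)%E.
Proof.
have := @indep_seq (enum D) (enum_uniq _) finset.set0 (fun=> setT)
  (finset.sub0set _).
move=> /(_ (fun=> measurableT)).
rewrite big_set0 mulr1 big_enum/= => <-.
  by apply: eq_integral => w _; rewrite big_set0 mulr1 big_enum.
by move=> i; rewrite mem_enum inE.
Qed.

End Independence.

(** * Laplace transform of the entry law *)

Section LaplaceTransform.
Context {R : realType} (mu : probability (measurableTypeR R) R).
Hypothesis mu_sym : symmetric_law mu.
Implicit Types x t : R.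

Lemma measurable_EFin_R (f : R -> R) : measurable_fun [set: R] f ->
  measurable_fun [set: measurableTypeR R] (fun t => (f t)%:E).
Proof. by move=> mf; exact/measurable_EFinP. Qed.

Lemma integral_symmetric_law (f : R -> R) : measurable_fun [set: R] f ->
  (forall t, 0 <= f t) ->
  (\int[mu]_t (f (- t))%:E = \int[mu]_t (f t)%:E)%E.
Proof.
move=> mf f0.
have mopp : measurable_fun [set: measurableTypeR R] (-%R : R -> measurableTypeR R).
  exact: oppr_measurable.
rewrite -(@ge0_integral_pushforward _ _ _ _ _ _ mopp mu setT (fun t => (f t)%:E))//.
- by apply: eq_measure_integral => A mA _; exact: mu_sym.
- exact: measurable_EFin_R.
- by move=> t _; rewrite lee_fin.
Qed.

Lemma mmt_gen_funE x : ('M_mu idfun x = \int[mu]_t (expR (x * t))%:E)%E.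
Proof.
rewrite /mmt_gen_fun unlock; apply: eq_integral => t _.
by rewrite /= mulrC.
Qed.

Lemma measurable_expR_mul x : measurable_fun [set: R] (fun t => expR (x * t)).
Proof. by apply: measurableT_comp => //; exact: measurable_funM. Qed.

Lemma measurable_coshR_mul x : measurable_fun [set: R] (fun t => coshR (x * t)).
Proof.
rewrite /coshR; apply: measurable_funM => //.
apply: measurable_funD; first exact: measurable_expR_mul.
under eq_fun do rewrite -mulNr.
exact: measurable_expR_mul.
Qed.

(** By symmetry t and -t may be averaged. Odd terms disappear, and pointwise bounds on [coshR]
    become bounds on the transform. *)
Lemma mmt_gen_fun_coshR x : ('M_mu idfun x = \int[mu]_t (coshR (x * t))%:E)%E.
Proof.
have mE := measurable_EFin_R (measurable_expR_mul _).
have h : (\int[mu]_t (expR (x * t) + expR ((- x) * t))%:E = 2%:E * 'M_mu idfun x)%E.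
  under eq_integral do rewrite EFinD.
  rewrite ge0_integralD//=.
  rewrite -mmt_gen_funE.
  have -> : (\int[mu]_t (expR (- x * t))%:E = 'M_mu idfun x)%E.
    rewrite mmt_gen_funE -[RHS]integral_symmetric_law//; last exact: measurable_expR_mul.
    by apply: eq_integral => t _; rewrite mulrN mulNr.
  by rewrite -mule2n mule_natl.
have -> : ('M_mu idfun x = 2^-1%:E * (2%:E * 'M_mu idfun x))%E.
  by rewrite muleA -EFinM mulVf// mul1e.
rewrite -h -ge0_integralZl//=.
- by apply: eq_integral => t _; rewrite /coshR mulNr -EFinM mulrC.
- by apply: measurable_EFin_R; apply: measurable_funD; exact: measurable_expR_mul.
Qed.

Lemma mmt_gen_fun_ge1 x : (1 <= 'M_mu idfun x)%E.
Proof.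
rewrite mmt_gen_fun_coshR -(@probability_setT _ _ _ mu) -[leLHS]mul1e.
rewrite -integral_cst//; apply: ge0_le_integral => //.
- exact: measurable_EFin_R (measurable_coshR_mul _).
- move=> t _; rewrite lee_fin (le_trans _ (coshR_ge _))// lerDl.
  by rewrite divr_ge0// sqr_ge0.
Qed.

(** Positive and negative parts have the same integral. If it is infinite, so is the difference, and
    [fine] still returns 0; hence the centering in the variance is by 0 in every case. *)
Lemma expectation_symmetric_law : fine ('E_mu[idfun]) = 0.
Proof.
rewrite unlock integralE.
have -> : (\int[mu]_t ((fun x : R => x%:E)^\- t) =
           \int[mu]_t ((fun x : R => x%:E)^\+ t))%E.
  transitivity (\int[mu]_t (Num.max (- t) 0 : R)%:E)%E.
    by apply: eq_integral => t _; rewrite funenegE EFin_max.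
  rewrite (@integral_symmetric_law (fun t : R => Num.max t 0)).
  - by apply: eq_integral => t _; rewrite funeposE EFin_max.
  - exact: measurable_maxr.
  - by move=> t; rewrite le_max lexx orbT.
by case: (\int[mu]_t _)%E => [r| |] //=; rewrite subrr.
Qed.

Hypothesis mu_var : ('V_mu[idfun] = 1)%E.

Lemma second_moment : (\int[mu]_t (t ^+ 2)%:E = 1)%E.
Proof.
rewrite -mu_var /variance unlock expectation_symmetric_law unlock.
by apply: eq_integral => t _; rewrite -{1}[t]subr0 expr2.
Qed.

Lemma measurable_quadratic (a : R) : measurable_fun [set: R] (fun t => 1 + a * t ^+ 2).
Proof. by apply: measurable_funD => //; exact: measurable_funM. Qed.

Lemma integral_quadratic (a : R) : 0 <= a ->
  (\int[mu]_t (1 + a * t ^+ 2)%:E = (1 + a)%:E)%E.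
Proof.
move=> a0; under eq_integral do rewrite EFinD.
rewrite ge0_integralD//=; last 2 first.
- by move=> t _; rewrite lee_fin mulr_ge0// sqr_ge0.
- by apply: measurable_EFin_R; exact: measurable_funM.
under [X in (_ + X)%E]eq_integral do rewrite EFinM.
rewrite integral_cst// ge0_integralZl//=; last 2 first.
- exact: measurable_EFin_R.
- by move=> t _; rewrite lee_fin sqr_ge0.
transitivity (1 * 1 + a%:E * 1)%E; last by rewrite mul1e mule1.
by congr (_ * _ + _ * _)%E; [exact: probability_setT|exact: second_moment].
Qed.

(** Integrating cosh y >= 1 + y^2 / 2 against unit variance gives 1 + x^2 / 2, to which
    [expR_subr_sqr] applies. *)
Lemma mmt_gen_fun_ge x : ((expR (x ^+ 2 / 2 - x ^+ 4 / 4))%:E <= 'M_mu idfun x)%E.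
Proof.
apply: (@le_trans _ _ (1 + x ^+ 2 / 2)%:E).
  have := @expR_subr_sqr R (x ^+ 2 / 2); rewrite divr_ge0 ?sqr_ge0// => /(_ isT).
  rewrite lee_fin; apply: le_trans.
  by rewrite le_eqVlt; apply/orP; left; apply/eqP; congr expR; field.
rewrite -integral_quadratic ?divr_ge0 ?sqr_ge0//.
rewrite mmt_gen_fun_coshR; apply: ge0_le_integral => //.
- by move=> t _; rewrite lee_fin addr_ge0// mulr_ge0 ?divr_ge0 ?sqr_ge0.
- exact: measurable_EFin_R (measurable_quadratic _).
- exact: measurable_EFin_R (measurable_coshR_mul _).
- move=> t _; rewrite lee_fin; apply: le_trans (coshR_ge _).
  by rewrite exprMn mulrAC.
Qed.

(** Second-order expansion whose remainder is cubic in x and dominated in t by cosh (2 t), which is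
    integrable. It combines e^(us) <= 1 + u s e^s for u <= 1, s^3 <= 6 e^s and e^(2s) <= 2 cosh (2
    s). *)
Lemma coshR_mul_le x t : `|x| <= 1 ->
  coshR (x * t) <= (1 + x ^+ 2 / 2 * t ^+ 2) + 6 * x ^+ 2 * `|x| * coshR (2 * t).
Proof.
move=> x1; apply: (le_trans (coshR_le _)); rewrite exprMn.
set u := `|x| in x1 *; set s := `|t|.
have u0 : 0 <= u by exact: normr_ge0.
have s0 : 0 <= s by exact: normr_ge0.
have -> : `|x * t| = u * s by rewrite normrM.
have e1 : expR (u * s) <= 1 + u * s * expR s.
  apply: (@le_trans _ _ (1 + u * s * expR (u * s))).
    have := expR_ge1Dx (- (u * s)); rewrite expRN.
    have := expR_gt0 (u * s); move: (expR _) => e e0 /(ler_wpM2r (ltW e0)).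
    rewrite mulVf ?gt_eqF//.
    by lra.
  by rewrite lerD2l ler_wpM2l ?mulr_ge0// ler_expR ler_piMl.
have e3 : s ^+ 3 <= 6 * expR s.
  have := expR_ge1Dxn 2 s0; rewrite -[3`!]/6%N => h.
  have -> : s ^+ 3 = 6 * (s ^+ 3 / 6) by field.
  by rewrite ler_pM2l//; apply: le_trans h; rewrite lerDr.
have e2 : expR s ^+ 2 <= 2 * coshR (2 * t).
  rewrite -expRM_natr /coshR /s.
  have -> : 2 * ((expR (2 * t) + expR (- (2 * t))) / 2) = expR (2 * t) + expR (- (2 * t)).
    by field.
  case: (ger0P t) => _; first by rewrite mulrC lerDl expR_ge0.
  by rewrite mulNr mulrC lerDr expR_ge0.
have tE : t ^+ 2 = s ^+ 2 by rewrite /s real_normK ?num_real.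
apply: (@le_trans _ _ (1 + x ^+ 2 / 2 * t ^+ 2 + x ^+ 2 / 2 * u * (s ^+ 3 * expR s))).
  have : x ^+ 2 * t ^+ 2 / 2 * expR (u * s) <= x ^+ 2 * t ^+ 2 / 2 * (1 + u * s * expR s).
    apply: ler_wpM2l => //; apply: divr_ge0 => //.
    by apply: mulr_ge0; exact: sqr_ge0.
  have -> : x ^+ 2 * t ^+ 2 / 2 * (1 + u * s * expR s) =
    x ^+ 2 / 2 * t ^+ 2 + x ^+ 2 / 2 * u * (s ^+ 3 * expR s) by rewrite tE; field.
  by lra.
have -> : 6 * x ^+ 2 * u * coshR (2 * t) = x ^+ 2 / 2 * u * (6 * (2 * coshR (2 * t))) by field.
rewrite lerD2l; apply: ler_wpM2l; first by rewrite mulr_ge0// divr_ge0// sqr_ge0.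
apply: (@le_trans _ _ (6 * expR s ^+ 2)); last by rewrite ler_pM2l.
by rewrite expr2 mulrA ler_pM2r// expR_gt0.
Qed.

Hypothesis A_lty : (subgauss_const mu < +oo)%E.

Lemma mmt_gen_fun_fin_num x : 'M_mu idfun x \is a fin_num.
Proof.
rewrite fin_numE; apply/andP; split.
  by apply/eqP => h; have := mmt_gen_fun_ge1 x; rewrite h.
apply/eqP => h; move: A_lty; rewrite /subgauss_const; apply/negP; rewrite -leNgt.
suff -> : ereal_sup (range (psi mu)) = +oo%E by rewrite mulry gtr0_sg// mul1e.
apply/eqP; rewrite -leye_eq; apply: ereal_sup_ubound; exists x => //.
(* At 0 the value of [psi] is conventional, but there the transform is the total mass 1. *)
rewrite /psi; case: eqP => [x0|/eqP x0]; last first.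
  by rewrite /logmgf h /= gt0_mulye// lte_fin invr_gt0 exprn_even_gt0.
move: h; rewrite x0 mmt_gen_funE.
under eq_integral do rewrite mul0r expR0.
by rewrite integral_cst// [X in (_ * X)%E]probability_setT.
Qed.

Lemma fine_mmt_gen_funK x : (fine ('M_mu idfun x))%:E = 'M_mu idfun x.
Proof. by rewrite fineK// mmt_gen_fun_fin_num. Qed.

Lemma fine_mmt_gen_fun_ge x : expR (x ^+ 2 / 2 - x ^+ 4 / 4) <= fine ('M_mu idfun x).
Proof. by rewrite -lee_fin fine_mmt_gen_funK; exact: mmt_gen_fun_ge. Qed.

Lemma fine_mmt_gen_fun_le x :
  fine ('M_mu idfun x) <= expR (fine (subgauss_const mu) / 2 * x ^+ 2).
Proof.
have [->|x0] := eqVneq x 0.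
  rewrite mmt_gen_funE; under eq_integral do rewrite mul0r expR0.
  rewrite integral_cst// [X in (_ * X)%E]probability_setT mule1/=.
  by rewrite expr0n mulr0 expR0.
have M1 : 1 <= fine ('M_mu idfun x).
  by rewrite -lee_fin fine_mmt_gen_funK mmt_gen_fun_ge1.
have M0 := lt_le_trans ltr01 M1.
have x2 : 0 < x ^+ 2 by rewrite exprn_even_gt0.
have psix : psi mu x = (ln (fine ('M_mu idfun x)) / x ^+ 2)%:E.
  by rewrite /psi (negbTE x0) /logmgf -fine_mmt_gen_funK lne_EFin// EFinM.
have := @ereal_sup_ubound _ (range (psi mu)) (psi mu x) (imageT _ _).
move: A_lty; rewrite /subgauss_const psix.
case: ereal_sup => [r| |] //=.
- move=> _; rewrite lee_fin ler_pdivrMr// => h.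
  rewrite -[leLHS]lnK ?posrE// ler_expR (le_trans h)//.
  by rewrite [2 * r]mulrC mulfK.
- by rewrite mulry gtr0_sg// mul1e.
Qed.

(** Unit variance makes the constant 1/2 sharp near 0, up to a relative error linear in |x|.
    Integrating [coshR_mul_le] gives 1 + x^2 / 2 + 6 x^2 |x| M(2), whence K = 12 M(2). *)
Lemma fine_mmt_gen_fun_le_near0 : exists2 K : R, 0 <= K &
  forall x, `|x| <= 1 -> fine ('M_mu idfun x) <= expR ((1 + K * `|x|) / 2 * x ^+ 2).
Proof.
pose M2 := fine ('M_mu idfun 2).
have M20 : 0 <= M2 by rewrite fine_ge0// (le_trans _ (mmt_gen_fun_ge1 2)).
exists (12 * M2); first by rewrite mulr_ge0.
move=> x x1; apply: (@le_trans _ _ (1 + x ^+ 2 / 2 + 6 * x ^+ 2 * `|x| * M2)); last first.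
  by rewrite -addrA; apply: le_trans (expR_ge1Dx _); rewrite lerD2l; nra.
have c0 : 0 <= 6 * x ^+ 2 * `|x| by rewrite mulr_ge0// mulr_ge0// sqr_ge0.
rewrite -lee_fin fine_mmt_gen_funK mmt_gen_fun_coshR EFinD EFinM.
rewrite -integral_quadratic ?divr_ge0 ?sqr_ge0// fine_mmt_gen_funK mmt_gen_fun_coshR.
have mq := measurable_EFin_R (measurable_quadratic (x ^+ 2 / 2)).
have mc := measurable_EFin_R (measurable_coshR_mul 2).
have cosh0 y : 0 <= coshR y :> R by exact/ltW/coshR_gt0.
rewrite -ge0_integralZl//=; last by move=> t _; rewrite lee_fin.
rewrite -ge0_integralD//=; last 3 first.
- by move=> t _; rewrite lee_fin addr_ge0// mulr_ge0 ?divr_ge0 ?sqr_ge0.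
- by move=> t _; rewrite -EFinM lee_fin mulr_ge0.
- exact: emeasurable_funM.
apply: ge0_le_integral => //=.
- by move=> t _; rewrite lee_fin.
- exact: measurable_EFin_R (measurable_coshR_mul _).
- by apply: emeasurable_funD => //; apply: emeasurable_funM.
- by move=> t _; rewrite -EFinM -EFinD lee_fin; exact: coshR_mul_le.
Qed.

End LaplaceTransform.

(** * Borel structure on row vectors, and reflections *)

Section SphereMeasurability.
Context {R : realType} {n : nat}.

Lemma measurable_coord_rV i :
  measurable_fun [set: borel_rV n] (fun e : borel_rV n => (e : 'rV[R]_n) 0 i).
Proof.
apply: (measurability _ (RGenOpens.measurableE R)).
move=> _ [_ [a [b ->] <-]]; rewrite setTI; apply: sub_sigma_algebra.
by move/continuousP : (@coord_continuous R 1 n 0 i); apply; exact: interval_open.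
Qed.

Lemma measurable_linear_form (v : 'rV[R]_n) :
  measurable_fun [set: borel_rV n] (fun e : borel_rV n => \sum_i v 0 i * (e : 'rV[R]_n) 0 i).
Proof.
apply: measurable_sum => i; apply: measurable_funM => //; exact: measurable_coord_rV.
Qed.

Lemma unit_sphereE (e : 'rV[R]_n) : unit_sphere e <-> \sum_i e 0 i ^+ 2 = 1.
Proof.
suff -> : \sum_i e 0 i ^+ 2 = (e *m e^T) 0 0 by [].
by rewrite mxE; apply: eq_bigr => i _; rewrite mxE expr2.
Qed.

Lemma measurable_unit_sphere : measurable (@unit_sphere R n : set (borel_rV n)).
Proof.
have -> : @unit_sphere R n = [set: borel_rV n] `&`
    (fun e : borel_rV n => \sum_i (e : 'rV[R]_n) 0 i ^+ 2) @^-1` [set 1].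
  by rewrite setTI; apply/seteqP; split => e /unit_sphereE.
suff : measurable_fun [set: borel_rV n] (fun e : borel_rV n => \sum_i (e : 'rV[R]_n) 0 i ^+ 2).
  by apply => //; exact: measurable_set1.
by apply: measurable_sum => i; apply: measurable_funX; exact: measurable_coord_rV.
Qed.

Lemma continuous_mulmxr_rV (O : 'M[R]_n) : continuous (fun e : 'rV[R]_n => e *m O).
Proof.
move=> e A [B eB BA]; rewrite nbhs_filterE.
have FF : Filter (nbhs e) := nbhs_filter (e : 'rV[R]_n).
suff : \forall f \near e, forall i j, B i j ((f *m O) i j).
  by apply: filterS => f; exact: BA.
apply: (@filter_forall _ _ (fun i f => forall j, B i j ((f *m O) i j)) (nbhs e)) => i.
apply: (@filter_forall _ _ (fun j f => B i j ((f *m O) i j)) (nbhs e)) => j.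
pose S s (f : 'rV[R]_n) : R := \sum_(k <- s) f i k * O k j.
have cvg_S s : S s @ e --> S s e.
  elim: s => [|k s ih].
    have -> : S [::] = cst 0 by apply/funext => f; rewrite /S big_nil.
    exact: cvg_cst.
  have -> : S (k :: s) = (fun f : 'rV[R]_n => f i k * O k j) \+ S s.
    by apply/funext => f; rewrite /S big_cons.
  by apply: cvgD ih; apply: cvgM; [exact: coord_continuous|exact: cvg_cst].
have cvg_entry : (fun f : 'rV[R]_n => (f *m O) i j) @ e --> (e *m O) i j.
  have -> : (fun f : 'rV[R]_n => (f *m O) i j) = S (index_enum _).
    by apply/funext => f; rewrite mxE.
  by rewrite mxE; exact: cvg_S.
exact: (cvg_entry _ (eB i j)).
Qed.

Lemma measurable_mulmxr_rV (O : 'M[R]_n) :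
  measurable_fun [set: borel_rV n] ((fun e : 'rV[R]_n => e *m O) : borel_rV n -> borel_rV n).
Proof.
apply: (@measurability _ _ (borel_rV n) (borel_rV n) setT _ (@open 'rV[R]_n) erefl).
move=> _ [A oA <-]; rewrite setTI; apply: sub_sigma_algebra.
by move/continuousP : (@continuous_mulmxr_rV O); exact.
Qed.

End SphereMeasurability.

(** Reflection in the hyperplane orthogonal to w = u - v. Equality of the lengths gives 2 <u, w> =
    |w|^2, so u is sent to u - w = v. *)
Lemma householder (F : realFieldType) n (u v : 'rV[F]_n) : u *m u^T = v *m v^T ->
  exists2 H : 'M[F]_n, H *m H^T = 1%:M & u *m H = v.
Proof.
move=> uv; have [w wE] : exists w, w = u - v by exists (u - v).
pose q := (w *m w^T) 0 0.
have [w0|w0] := eqVneq w 0.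
  exists 1%:M; first by rewrite trmx1 mulmx1.
  by rewrite mulmx1; apply/eqP; rewrite -subr_eq0 -wE w0.
have qE : w *m w^T = q%:M by rewrite [LHS]mx11_scalar.
have q0 : q != 0.
  apply: contra_neq w0 => q0; apply/rowP => i; rewrite mxE.
  move: q0; rewrite /q mxE => /eqP; rewrite psumr_eq0; last first.
    by move=> j _; rewrite mxE -expr2 sqr_ge0.
  move=> /allP/(_ i (mem_index_enum _)).
  by rewrite mxE -expr2 sqrf_eq0 => /eqP.
have uw : 2 * (u *m w^T) 0 0 = q.
  have e1 : (u *m u^T) 0 0 = (v *m v^T) 0 0 by rewrite uv.
  have e2 : (u *m v^T) 0 0 = (v *m u^T) 0 0.
    by rewrite !mxE; apply: eq_bigr => i _; rewrite !mxE mulrC.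
  move: e1 e2; rewrite /q wE linearB/= mulmxBr mulmxBl !mulmxBr !(mxE, mul0r).
  by move=> e1 e2; lra.
pose H : 'M[F]_n := 1%:M - (2 / q) *: (w^T *m w).
have HT : H^T = H by rewrite /H linearB/= trmx1 linearZ/= trmx_mul trmxK.
exists H.
  rewrite HT {1}/H mulmxBl mul1mx -scalemxAl.
  have -> : w^T *m w *m H = - (w^T *m w).
    rewrite /H mulmxBr mulmx1 -scalemxAr mulmxA -(mulmxA w^T) qE mul_mx_scalar.
    rewrite -scalemxAl scalerA -[X in X - _]scale1r -scalerBl.
    by rewrite (_ : 1 - 2 / q * q = -1) ?scaleN1r//; field.
  by rewrite scalerN opprK /H subrK.
rewrite /H mulmxBr mulmx1 -scalemxAr mulmxA [u *m w^T]mx11_scalar mul_scalar_mx scalerA.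
have -> : 2 / q * (u *m w^T) 0 0 = 1 by rewrite mulrAC uw divff.
by rewrite scale1r wE opprB addrC subrK.
Qed.

(** Comparison with one term of the exponential series; the sixth power is the one that controls the
    quartic correction in the lower bound. *)
Lemma expo6_le_expR (R : realType) : exists2 C : R, 0 <= C &
  forall y, 0 <= y -> y ^+ 6 <= C * expR y.
Proof.
have f0 : 0 < (6`!)%:R :> R by rewrite ltr0n fact_gt0.
exists (6`!)%:R; first exact: ltW.
move=> y y0; have := expR_ge1Dxn 5 y0; move: (6`!)%:R f0 => c c0 h.
by rewrite -ler_pdivrMl// mulrC; apply: le_trans h; rewrite lerDr.
Qed.

(** * Exponential moments of the uniform law on the sphere *)

Section UniformOnSphere.
Context {R : realType} {n : nat} (Q : probability (@borel_rV R n.+1) R).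
Hypothesis Q_unif : uniform_on_sphere Q.
Local Notation N := (n.+1%:R : R).
Local Notation "e ` i" := ((e : 'rV[R]_n.+1) 0 i) (at level 5).
Local Notation B := (@borel_rV R n.+1).
Implicit Types f g : B -> R.

Lemma measurable_EFin_rV f : measurable_fun [set: B] f ->
  measurable_fun [set: B] (fun e : B => (f e)%:E).
Proof. by move=> mf; exact/measurable_EFinP. Qed.

(** The complement of the sphere is negligible, so the integrands have to be compared on unit
    vectors only. *)
Lemma le_integral_sphere f g :
  measurable_fun [set: B] f -> measurable_fun [set: B] g ->
  (forall e : B, 0 <= f e) -> (forall e : B, 0 <= g e) ->
  (forall e : B, \sum_i e`i ^+ 2 = 1 -> f e <= g e) ->
  (\int[Q]_e (f e)%:E <= \int[Q]_e (g e)%:E)%E.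
Proof.
move=> mf mg f0 g0 fg; apply: ae_ge0_le_integral => //.
- by move=> e _; rewrite lee_fin.
- exact: (measurable_EFin_rV mf).
- by move=> e _; rewrite lee_fin.
- exact: (measurable_EFin_rV mg).
have mS := @measurable_unit_sphere R n.+1.
exists (~` @unit_sphere R n.+1); split; first exact: measurableC.
  have := probability_setC Q mS; case: Q_unif => -> _.
  by rewrite subee.
move=> e /=; apply: contra_not => /unit_sphereE e1 _.
by rewrite lee_fin fg.
Qed.

Lemma measurable_expR_linear_form (v : 'rV[R]_n.+1) :
  measurable_fun [set: B] (fun e : B => expR (\sum_i v 0 i * e`i)).
Proof. by apply: measurableT_comp => //; exact: measurable_linear_form. Qed.

(** A reflection [H] sends u to v; <u H, e> = <u, e H^T>, and the law is invariant under H^T. *)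
Lemma integral_expR_linear_form_eq (u v : 'rV[R]_n.+1) :
  \sum_i u 0 i ^+ 2 = \sum_i v 0 i ^+ 2 ->
  (\int[Q]_e (expR (\sum_i u 0 i * e`i))%:E =
   \int[Q]_e (expR (\sum_i v 0 i * e`i))%:E)%E.
Proof.
move=> uv.
have formE (w e : 'rV[R]_n.+1) : \sum_i w 0 i * e 0 i = (w *m e^T) 0 0.
  by rewrite mxE; apply: eq_bigr => i _; rewrite mxE.
have [|H HT uH] := @householder R _ u v.
  apply/matrixP => i j; rewrite !ord1 -!formE.
  by move: uv; under eq_bigr do rewrite expr2; under [in RHS]eq_bigr do rewrite expr2.
have HT' : H^T *m H^T^T = 1%:M by rewrite trmxK; exact: mulmx1C.
case: Q_unif => _ /(_ _ HT') inv.
have mu := measurable_EFin_rV (measurable_expR_linear_form u).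
have mH := @measurable_mulmxr_rV R n.+1 H^T.
transitivity (\int[Q]_e (expR (\sum_i u 0 i * (e *m H^T : 'rV[R]_n.+1) 0 i))%:E)%E; last first.
  by apply: eq_integral => e _; rewrite !formE -uH trmx_mul trmxK mulmxA.
have := @ge0_integral_pushforward _ _ _ _ _ _ mH Q setT _ measurableT mu.
rewrite preimage_setT => <-; last by move=> e _; rewrite lee_fin expR_ge0.
by apply: eq_measure_integral => A mA _; exact/esym/inv.
Qed.

Lemma integral_expR_linear_form_le (v : 'rV[R]_n.+1) :
  (\int[Q]_e (expR (\sum_i v 0 i * e`i))%:E <=
   (expR ((\sum_i v 0 i ^+ 2) / (2 * N)))%:E)%E.
Proof.
pose V := \sum_i v 0 i ^+ 2; pose c := Num.sqrt (V / N).
have V0 : 0 <= V by apply: sumr_ge0 => i _; exact: sqr_ge0.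
have N0 : 0 < N by rewrite ltr0n.
have cE : c ^+ 2 = V / N by rewrite sqr_sqrtr// divr_ge0// ltW.
(* All 2^N vectors with entries c or -c have the length of [v], hence the same integral; summing
   over the signs produces the product of the 2 cosh (c e_i). *)
pose u (b : {ffun 'I_n.+1 -> bool}) : 'rV[R]_n.+1 := \row_i ((-1) ^+ b i * c).
have uv b : \sum_i v 0 i ^+ 2 = \sum_i u b 0 i ^+ 2.
  under [in RHS]eq_bigr do rewrite mxE exprMn -exprM mulnC exprM sqrrN expr1n expr1n mul1r cE.
  rewrite sumr_const card_ord -[RHS]mulr_natr divfK// gt_eqF//.
have two_coshR i (e : B) : 2 * coshR (c * e`i) = \sum_(b : bool) expR ((-1) ^+ b * c * e`i).
  by rewrite big_bool /= expr0 expr1 mul1r mulN1r mulNr /coshR mulrC divfK// addrC.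
suff : ((2 ^+ n.+1)%:E * \int[Q]_e (expR (\sum_i v 0 i * e`i))%:E <=
    (2 ^+ n.+1)%:E * (expR (V / (2 * N)))%:E)%E.
  by rewrite lee_pmul2l// lte_fin exprn_gt0.
have -> : ((2 ^+ n.+1)%:E * \int[Q]_e (expR (\sum_i v 0 i * e`i))%:E =
    \int[Q]_e (\prod_i (2 * coshR (c * e`i)))%:E)%E.
  transitivity (\sum_(b : {ffun 'I_n.+1 -> bool})
     \int[Q]_e (expR (\sum_i u b 0 i * e`i))%:E)%E.
    under [RHS]eq_bigr do rewrite -(integral_expR_linear_form_eq (uv _)).
    rewrite sumr_const card_ffun card_bool card_ord.
    by rewrite -[RHS]mule_natl natrX.
  rewrite -ge0_integral_sum//; last first.
    by move=> b; exact: measurable_EFin_rV (measurable_expR_linear_form _).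
  apply: eq_integral => x _; rewrite sumEFin; congr EFin.
  under [RHS]eq_bigr do rewrite two_coshR.
  rewrite bigA_distr_bigA; apply: eq_bigr => b _.
  by rewrite expR_sum; apply: eq_bigr => i _; rewrite mxE.
have VE : V / (2 * N) = c ^+ 2 / 2 by rewrite cE -mulrA -invfM [N * _]mulrC.
rewrite -EFinM VE.
have -> : ((2 ^+ n.+1 * expR (c ^+ 2 / 2))%:E =
    \int[Q]_e (2 ^+ n.+1 * expR (c ^+ 2 / 2))%:E)%E.
  by rewrite integral_cst// [X in (_ * X)%E]probability_setT mule1.
have mc i : measurable_fun [set: B] (fun e : B => coshR (c * e`i)).
  rewrite /coshR; apply: measurable_funM => //.
  have mx : measurable_fun [set: B] (fun e : B => c * e`i).
    by apply: measurable_funM => //; exact: measurable_coord_rV.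
  apply: measurable_funD; first exact: measurableT_comp.
  by apply: measurableT_comp => //; exact: measurableT_comp.
have c0 x : 0 <= 2 * coshR x :> R by rewrite mulr_ge0// ltW// coshR_gt0.
apply: (@le_integral_sphere (fun e => \prod_i (2 * coshR (c * e`i)))
  (fun=> 2 ^+ n.+1 * expR (c ^+ 2 / 2))) => //.
- by apply: measurable_prod => i _; exact: measurable_funM.
- by move=> e; apply: prodr_ge0.
move=> e e1; rewrite big_split/= prodr_const card_ord ler_pM2l ?exprn_gt0//.
have -> : c ^+ 2 / 2 = \sum_i (c * e`i) ^+ 2 / 2.
  by under eq_bigr do rewrite exprMn; rewrite -mulr_suml -mulr_sumr e1 mulr1.
rewrite expR_sum; apply: ler_prod => i _.
by rewrite coshR_le_expR andbT ltW// coshR_gt0.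
Qed.

(** The hypothesis on C bounds (sqrt N e_i)^6 by C times the sum of exp (sqrt N e_i) and exp (- sqrt
    N e_i), each of mean at most e^(1/2). Dividing by N^3 and summing N coordinates gives the order
    N^(-2). *)
Lemma integral_sum_expo6_le (C : R) : 0 <= C ->
  (forall y, 0 <= y -> y ^+ 6 <= C * expR y) ->
  (\int[Q]_e (\sum_i e`i ^+ 6)%:E <= (2 * C * expR 2^-1 / N ^+ 2)%:E)%E.
Proof.
move=> C0 x6.
have N0 : 0 < N by rewrite ltr0n.
have mX i k : measurable_fun [set: B] (fun e : B => e`i ^+ k).
  by apply: measurable_funX; exact: measurable_coord_rV.
under eq_integral do rewrite -sumEFin.
rewrite ge0_integral_sum//; last 2 first.
- by move=> i; exact: measurable_EFin_rV.
- by move=> i e _; rewrite lee_fin exprn_even_ge0.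
pose d (s : R) (i : 'I_n.+1) : 'rV[R]_n.+1 := \row_j (if j == i then s * Num.sqrt N else 0).
have dE s i (e : B) : \sum_j d s i 0 j * e`j = s * Num.sqrt N * e`i.
  rewrite (bigD1 i)//= big1 ?addr0; first by rewrite mxE eqxx.
  by move=> j /negbTE ji; rewrite mxE ji mul0r.
have dd s i : s ^+ 2 = 1 -> (\int[Q]_e (expR (s * Num.sqrt N * e`i))%:E <= (expR 2^-1)%:E)%E.
  move=> s1; under eq_integral do rewrite -dE.
  apply: (le_trans (integral_expR_linear_form_le _)); rewrite lee_fin ler_expR.
  rewrite (bigD1 i)//= big1 ?addr0.
    rewrite mxE eqxx exprMn s1 mul1r sqr_sqrtr ?(ltW N0)//.
    by rewrite invfM mulrCA divff ?mulr1 ?lexx// gt_eqF.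
  by move=> j /negbTE ji; rewrite mxE ji expr0n.
have mE s i : measurable_fun [set: B] (fun e : B => expR (s * Num.sqrt N * e`i)).
  by under eq_fun do rewrite -dE; exact: measurable_expR_linear_form.
have one i : (\int[Q]_e (e`i ^+ 6)%:E <= (2 * C * expR 2^-1 / N ^+ 3)%:E)%E.
  pose k := C / N ^+ 3.
  have k0 : 0 <= k by rewrite divr_ge0// exprn_ge0// ltW.
  apply: (@le_trans _ _ (\int[Q]_e (k%:E * ((expR (1 * Num.sqrt N * e`i))%:E +
     (expR (-1 * Num.sqrt N * e`i))%:E)))%E).
    apply: ge0_le_integral => //.
    - by move=> e _; rewrite lee_fin exprn_even_ge0.
    - exact: measurable_EFin_rV.
    - apply: emeasurable_funM => //; apply: emeasurable_funD; exact: measurable_EFin_rV.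
    move=> e _; rewrite -EFinD -EFinM lee_fin mul1r mulN1r mulNr.
    have -> : e`i ^+ 6 = (Num.sqrt N * e`i) ^+ 6 / N ^+ 3.
      have -> : (Num.sqrt N * e`i) ^+ 6 = (Num.sqrt N ^+ 2) ^+ 3 * e`i ^+ 6.
        by rewrite exprMn -exprM.
      by rewrite sqr_sqrtr ?(ltW N0)// mulrAC divff ?mul1r// expf_neq0// gt_eqF.
    rewrite /k [leRHS]mulrAC ler_pM2r ?invr_gt0 ?exprn_gt0//.
    move: (Num.sqrt N * _) => x.
    have [x0|x0] := leP 0 x.
      by apply: (le_trans (x6 _ x0)); rewrite ler_wpM2l// lerDl expR_ge0.
    have -> : x ^+ 6 = (- x) ^+ 6 by rewrite exprNn -signr_odd expr0 mul1r.
    apply: (le_trans (x6 (- x) _)); first by rewrite oppr_ge0 ltW.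
    by rewrite ler_wpM2l// lerDr expR_ge0.
  rewrite ge0_integralZl//; last 2 first.
  - by apply: emeasurable_funD; exact: measurable_EFin_rV.
  - by move=> e _; rewrite -EFinD lee_fin addr_ge0 ?expR_ge0.
  rewrite ge0_integralD//; last 2 first.
  - exact: measurable_EFin_rV.
  - exact: measurable_EFin_rV.
  apply: (@le_trans _ _ (k%:E * ((expR 2^-1)%:E + (expR 2^-1)%:E))%E).
    by apply: lee_wpmul2l => //; apply: leeD; apply: dd; rewrite ?sqrrN expr1n.
  rewrite -EFinD -EFinM lee_fin /k le_eqVlt; apply/orP; left; apply/eqP.
  by field; rewrite gt_eqF.
apply: (le_trans (lee_sum _ (fun i _ => one i))).
rewrite sumEFin sumr_const card_ord lee_fin -[leLHS]mulr_natr le_eqVlt.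
by apply/orP; left; apply/eqP; field; rewrite gt_eqF.
Qed.

(** Expanding over choice functions b gives exponentials of linear forms with coefficients s(b i)
    sqrt N. Their bound exp (sum_i s(b i)^2 / 2) is exactly cancelled by the factors exp (- s^2 /
    2), and the total weight remains. *)
Lemma integral_prod_mixture_le (J : finType) (w s : J -> R) : (forall j, 0 <= w j) ->
  (\int[Q]_e (\prod_i \sum_j w j * expR (s j * (Num.sqrt N * e`i) - s j ^+ 2 / 2))%:E <=
   ((\sum_j w j) ^+ n.+1)%:E)%E.
Proof.
move=> w0; have N0 : 0 < N by rewrite ltr0n.
pose u (b : {ffun 'I_n.+1 -> J}) : 'rV[R]_n.+1 := \row_i (s (b i) * Num.sqrt N).
pose k (b : {ffun 'I_n.+1 -> J}) := \prod_i (w (b i) * expR (- (s (b i) ^+ 2 / 2))).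
have k0 b : 0 <= k b by apply: prodr_ge0 => i _; rewrite mulr_ge0 ?expR_ge0.
have mu b := measurable_EFin_rV (measurable_expR_linear_form (u b)).
have -> : (\int[Q]_e (\prod_i \sum_j w j * expR (s j * (Num.sqrt N * e`i) - s j ^+ 2 / 2))%:E =
    \int[Q]_e \sum_b ((k b)%:E * (expR (\sum_i u b 0 i * e`i))%:E))%E.
  apply: eq_integral => e _; under [RHS]eq_bigr do rewrite -EFinM.
  rewrite sumEFin; congr EFin; rewrite bigA_distr_bigA; apply: eq_bigr => b _.
  rewrite expR_sum -big_split/=; apply: eq_bigr => i _.
  by rewrite mxE expRD mulrA [LHS]mulrAC mulrA.
rewrite ge0_integral_sum//; last 2 first.
- by move=> b; apply: emeasurable_funM.
- by move=> b e _; rewrite -EFinM lee_fin mulr_ge0 ?expR_ge0.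
rewrite -[X in (X%:E)%E](_ : \prod_(i < n.+1) \sum_j w j = _); last first.
  by rewrite prodr_const card_ord.
rewrite bigA_distr_bigA -sumEFin; apply: lee_sum => b _.
rewrite ge0_integralZl//; last by rewrite lee_fin.
apply: (@le_trans _ _ ((k b)%:E * (expR ((\sum_i u b 0 i ^+ 2) / (2 * N)))%:E)%E).
  by apply: lee_wpmul2l; [rewrite lee_fin|exact: integral_expR_linear_form_le].
rewrite -EFinM lee_fin /k big_split/= -expR_sum -mulrA -expRD.
rewrite [X in expR X](_ : _ = 0) ?expR0 ?mulr1//.
rewrite mulr_suml -big_split/= big1// => i _.
rewrite mxE exprMn sqr_sqrtr ?(ltW N0)//.
by field; rewrite gt_eqF.
Qed.

End UniformOnSphere.

(** * Exponential cost of the large coordinates *)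

(** By completing the square, g a - g^2 / 2 = a^2 / 2 - (a - g)^2 / 2. The integer part of |a|, with
    the sign of a, is within 1 of a, so this single term already suffices with loss e^(1/2). *)
Lemma expR_sqr_half_le (R : realType) (m : nat) (a : R) : `|a| <= m%:R ->
  expR (a ^+ 2 / 2) <= expR 2^-1 * \sum_(j : bool * 'I_m.+1)
    expR ((-1) ^+ j.1 * j.2%:R * a - ((-1) ^+ j.1 * j.2%:R) ^+ 2 / 2).
Proof.
move=> am; pose g := Num.truncn `|a|.
have /andP[ga ag] := truncn_itv (normr_ge0 a).
have gm : (g < m.+1)%N by rewrite ltnS -(ler_nat R) (le_trans ga).
pose j0 : bool * 'I_m.+1 := (a < 0, Ordinal gm).
rewrite (bigD1 j0)//= mulrDr; apply: ler_wpDr.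
  by rewrite mulr_ge0 ?expR_ge0// sumr_ge0// => j _; exact: expR_ge0.
rewrite -expRD ler_expR -/g.
have -> : (-1) ^+ (a < 0)%R * g%:R * a = g%:R * `|a|.
  by rewrite mulrAC -normrEsign mulrC.
rewrite exprMn sqrr_sign mul1r -[a ^+ 2]real_normK ?num_real//.
move: ag ga; rewrite -/g -natr1.
move: `|a| (g%:R : R) => x y xy yx.
have : (x - y) ^+ 2 <= 1 by rewrite expr_le1 ?subr_ge0//; lra.
by rewrite sqrrB; lra.
Qed.

Section LargeCoordinates.
Context {R : realType} {n : nat} (Q : probability (@borel_rV R n.+1) R).
Hypothesis Q_unif : uniform_on_sphere Q.
Local Notation N := (n.+1%:R : R).
Local Notation "e ` i" := ((e : 'rV[R]_n.+1) 0 i) (at level 5).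
Local Notation B := (@borel_rV R n.+1).

Lemma measurable_large_mass (t : R) : measurable_fun [set: B]
  (fun e : B => \sum_i (t < e`i ^+ 2)%R%:R * e`i ^+ 2).
Proof.
have mX i : measurable_fun [set: B] (fun e : B => e`i ^+ 2).
  by apply: measurable_funX; exact: measurable_coord_rV.
apply: measurable_sum => i; apply: measurable_funM; last exact: mX.
by apply: measurable_natmul_bool; apply: measurable_fun_ltr.
Qed.

(** Logarithmic cost of one large coordinate: e^(1/2) from [expR_sqr_half_le], times N^2 to undo the
    weight N^(-2). *)
Let l : R := 2^-1 + 2 * ln N.
(** The index [(false, ord0)] has frequency 0. Its additional mass 1 keeps the mixture at least 1,
    as a small coordinate demands. *)
Let weight (j : bool * 'I_n.+2) : R := (N ^+ 2)^-1 + (j == (false, ord0))%:R.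
Let freq (j : bool * 'I_n.+2) : R := (-1) ^+ j.1 * j.2%:R.
Let term (x : R) j := weight j * expR (freq j * x - freq j ^+ 2 / 2).

Let N_gt0 : 0 < N. Proof. by rewrite ltr0n. Qed.

Let sum_term x : \sum_j term x j =
  1 + (N ^+ 2)^-1 * \sum_j expR (freq j * x - freq j ^+ 2 / 2).
Proof.
under eq_bigr do rewrite /term /weight mulrDl.
rewrite big_split/= -mulr_sumr addrC; congr (_ + _).
rewrite (bigD1 (false, ord0))//= big1 ?addr0.
  by rewrite /freq/= ?eqxx mul1r mulr0 mul0r expr0n mul0r subr0 expR0.
by move=> j /negbTE ->; rewrite mul0r.
Qed.

Let coord_le x : `|x| <= 1 -> `|Num.sqrt N * x| <= n.+1%:R.
Proof.
move=> x1; rewrite normrM ger0_norm ?sqrtr_ge0//.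
have N1 : 1 <= N by rewrite ler1n.
apply: (@le_trans _ _ (Num.sqrt N)); first by rewrite ler_piMr// sqrtr_ge0.
by rewrite -[leRHS](ger0_norm (ltW N_gt0)) -sqrtr_sqr ler_sqrt ?exprn_gt0// ler_eXnr.
Qed.

Let factor_le (t x : R) : `|x| <= 1 ->
  expR (N / 2 * ((t < x ^+ 2)%R%:R * x ^+ 2)) <=
  expR (l * (t < x ^+ 2)%R%:R) * \sum_j term (Num.sqrt N * x) j.
Proof.
move=> x1; rewrite sum_term.
set h := \sum_j _; have h0 : 0 <= h by apply: sumr_ge0 => j _; exact: expR_ge0.
have lam0 : 0 < (N ^+ 2)^-1 by rewrite invr_gt0 exprn_gt0.
case: ltP => _ /=; last first.
  by rewrite mul0r !mulr0 expR0 mul1r lerDl mulr_ge0// ltW.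
rewrite mul1r mulr1.
have -> : N / 2 * x ^+ 2 = (Num.sqrt N * x) ^+ 2 / 2.
  by rewrite exprMn sqr_sqrtr ?(ltW N_gt0)// mulrAC.
apply: (le_trans (expR_sqr_half_le (coord_le x1))).
rewrite -/h /l expRD -mulrA ler_pM2l ?expR_gt0//.
have -> : expR (2 * ln N) = N ^+ 2 by rewrite expRM_natl lnK.
by rewrite mulrDr mulr1 mulrA divff ?mul1r ?lerDr ?exprn_ge0// expf_neq0// gt_eqF.
Qed.

(* Each large coordinate [x] contributes [exp (N x^2 / 2)], which is at most
   [e^(1/2)] times a sum over integers [|g| <= N] of [exp (g y - g^2 / 2)] with
   [y = sqrt N x] (take [g] next to [y]).  The weight [N^-2] given to these
   exponentials in the mixture, whose total mass per coordinate is [1 + O(1/N)],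
   costs [N^2] for each of the at most [1 / t] large coordinates. *)
Lemma integral_expR_large_le (t : R) : 0 < t ->
  (\int[Q]_e (expR (N / 2 * \sum_i (t < e`i ^+ 2)%R%:R * e`i ^+ 2))%:E <=
   (expR (l / t + 4))%:E)%E.
Proof.
move=> t0.
have l0 : 0 <= l by rewrite addr_ge0// mulr_ge0// ln_ge0// ler1n.
have w0 j : 0 <= weight j by rewrite addr_ge0// invr_ge0 exprn_ge0// ltW.
have sw : \sum_j weight j = 1 + (N ^+ 2)^-1 * (2 * (N + 1)).
  rewrite big_split/= sumr_const card_prod card_bool card_ord addrC; congr (_ + _).
    rewrite (bigD1 (false, ord0))//= big1 ?addr0 ?eqxx//.
    by move=> j /negbTE ->.
  by rewrite -[LHS]mulr_natr natrM natr1.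
have mt j : measurable_fun [set: R] (term^~ j).
  apply: measurable_funM => //; apply: measurableT_comp => //.
  by apply: measurable_funB => //; exact: measurable_funM.
have mterm : measurable_fun [set: B] (fun e : B => \prod_i \sum_j term (Num.sqrt N * e`i) j).
  apply: measurable_prod => i _; apply: measurable_sum => j.
  apply: (measurableT_comp (mt j)); apply: measurable_funM => //.
  exact: measurable_coord_rV.
have term0 x j : 0 <= term x j by rewrite mulr_ge0 ?expR_ge0.
apply: (@le_trans _ _ (\int[Q]_e (expR (l / t) *
    \prod_i \sum_j term (Num.sqrt N * e`i) j)%:E)%E).
  apply: (le_integral_sphere Q_unif) => //.
  - apply: measurableT_comp => //; apply: measurable_funM => //.
    exact: measurable_large_mass.
  - exact: measurable_funM.
  - move=> e; apply: mulr_ge0; first exact: expR_ge0.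
    by apply: prodr_ge0 => i _; apply: sumr_ge0.
  move=> e e1; have e1' i : `|e`i| <= 1.
    rewrite -(@expr_le1 _ 2)// real_normK ?num_real// -e1 (bigD1 i)//= lerDl.
    by apply: sumr_ge0 => j _; exact: sqr_ge0.
  rewrite mulr_sumr expR_sum.
  apply: (@le_trans _ _ (\prod_i (expR (l * (t < e`i ^+ 2)%R%:R) *
     \sum_j term (Num.sqrt N * e`i) j))).
    by apply: ler_prod => i _; rewrite expR_ge0 factor_le.
  rewrite big_split/= -expR_sum -mulr_sumr ler_wpM2r//.
    by apply: prodr_ge0 => i _; apply: sumr_ge0.
  (* Each large coordinate takes more than [t] of the total mass 1, so their number is at most 1 /
     t. *)
  rewrite ler_expR ler_wpM2l// -[leRHS]mul1r ler_pdivlMr// -[leRHS]e1 mulr_suml.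
  apply: ler_sum => i _; case: ltP => [/ltW//|_]; rewrite ?mul1r ?mul0r//.
  exact: sqr_ge0.
under eq_integral do rewrite EFinM.
rewrite ge0_integralZl//=; last 2 first.
- exact: (measurable_EFin_rV mterm).
- by move=> e _; rewrite lee_fin; apply: prodr_ge0 => i _; apply: sumr_ge0.
rewrite expRD EFinM; apply: lee_wpmul2l; first by rewrite lee_fin expR_ge0.
apply: (le_trans (integral_prod_mixture_le Q_unif _ w0)).
rewrite sw lee_fin; set x := _^-1 * _.
have x0 : 0 <= x by rewrite mulr_ge0 ?mulr_ge0 ?addr_ge0 ?invr_ge0 ?exprn_ge0 ?(ltW N_gt0).
(* (1 + x)^N <= exp (N x), and N x = 2 (N + 1) / N <= 4: this is the constant 4 of the statement. *)
apply: (@le_trans _ _ (expR x ^+ n.+1)).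
  by rewrite lerXn2r ?nnegrE ?expR_ge0 ?addr_ge0// expR_ge1Dx.
rewrite -expRM_natr ler_expR /x.
have -> : (N ^+ 2)^-1 * (2 * (N + 1)) * N = 2 * (N + 1) / N.
  by have N0 := N_gt0; move: N N0 => x0' ?; field; rewrite gt_eqF.
have N1 : 1 <= N by rewrite ler1n.
by rewrite ler_pdivrMr//; lra.
Qed.

End LargeCoordinates.

(** * Averaging over the matrix for a fixed vector *)

Lemma integral_has_law (R : realType) d (T : measurableType d) (P : probability T R)
    (Y : T -> R) (mu : probability (measurableTypeR R) R) (f : R -> R) :
  has_law P Y mu -> measurable_fun [set: R] f -> (forall x, 0 <= f x) ->
  (\int[P]_w (f (Y w))%:E = \int[mu]_x (f x)%:E)%E.
Proof.
move=> [mY lawY] mf f0.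
have mf' := measurable_EFin_R mf.
have := @ge0_integral_pushforward _ _ _ _ _ _ mY P setT _ measurableT mf'.
rewrite preimage_setT => <-; last by move=> x _; rewrite lee_fin.
by apply: eq_measure_integral => A mA _; exact: lawY.
Qed.

Section QuadraticForm.
Context {R : realFieldType} {n : nat}.

Definition pair_mult (p : 'I_n * 'I_n) : R := if p.1 == p.2 then 1 else 2.

Lemma sum_symmetric_pairs (F : 'I_n -> 'I_n -> R) : (forall i j, F i j = F j i) ->
  \sum_i \sum_j F i j =
  \sum_(p in [set p : 'I_n * 'I_n | (p.1 <= p.2)%N]%SET) pair_mult p * F p.1 p.2.
Proof.
move=> Fsym; rewrite pair_bigA/=.
under [RHS]eq_bigl do rewrite inE.
have -> : \sum_(p : 'I_n * 'I_n | (p.1 <= p.2)%N) pair_mult p * F p.1 p.2 =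
    \sum_(p : 'I_n * 'I_n | (p.1 <= p.2)%N) F p.1 p.2 +
    \sum_(p : 'I_n * 'I_n | (p.1 < p.2)%N) F p.1 p.2.
  rewrite [X in _ + X](_ : _ = \sum_(p : 'I_n * 'I_n | (p.1 <= p.2)%N)
    (if p.1 != p.2 then F p.1 p.2 else 0)).
    rewrite -big_split/=; apply: eq_bigr => p _; rewrite /pair_mult.
    by case: eqP => _; rewrite ?mul1r ?addr0// mulr2n mulrDl !mul1r.
  rewrite -big_mkcondr/=; apply: eq_bigl => p.
  by rewrite ltn_neqAle andbC -val_eqE eq_sym.
rewrite (bigID (fun p : 'I_n * 'I_n => (p.1 <= p.2)%N))/=; congr (_ + _).
rewrite (reindex_inj (h := fun p : 'I_n * 'I_n => (p.2, p.1)))/=; last first.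
  by move=> [a b] [c d] /= [-> ->].
by apply: eq_big => [p|p _]; rewrite ?ltnNge.
Qed.

Lemma quadratic_formE (e : 'rV[R]_n) (M : 'M[R]_n) : M^T = M ->
  (e *m M *m e^T) 0 0 =
  \sum_(p in [set p : 'I_n * 'I_n | (p.1 <= p.2)%N]%SET)
    pair_mult p * (e 0 p.1 * e 0 p.2 * M p.1 p.2).
Proof.
move=> MT; rewrite -(@sum_symmetric_pairs (fun i j => e 0 i * e 0 j * M i j)).
  rewrite mxE exchange_big/=; apply: eq_bigr => j _.
  rewrite !mxE mulr_suml; apply: eq_bigr => i _.
  by rewrite [RHS]mulrAC.
by move=> i j; rewrite -[in LHS]MT mxE [e 0 i * _]mulrC.
Qed.

End QuadraticForm.

Section WignerLaplace.
Context {R : realType} (mu : probability (measurableTypeR R) R).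
Hypothesis mu_sym : symmetric_law mu.
Hypothesis A_lty : (subgauss_const mu < +oo)%E.
Context {n : nat} {d} {T : measurableType d} (P : probability T R).
Context (X : T -> 'M[R]_n.+1) (X_wigner : wigner mu P X) (theta : R).
Context (Q : probability (@borel_rV R n.+1) R).
Local Notation N := (n.+1%:R : R).
Local Notation B := (@borel_rV R n.+1).
Local Notation D := [set p : 'I_n.+1 * 'I_n.+1 | (p.1 <= p.2)%N]%SET.

(* The normalization is such that [N theta * pair_mult p * e_i e_j * X_ij]
   is [tilt e p] times a variable of law [mu]. *)
Definition tilt (e : 'rV[R]_n.+1) (p : 'I_n.+1 * 'I_n.+1) : R :=
  theta * Num.sqrt (2 * N * pair_mult p) * (e 0 p.1 * e 0 p.2).

(** For fixed e the quadratic form is a linear combination of the independent entries on and above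
    the diagonal, so its exponential factorizes. *)
Lemma integral_expR_quadratic_form (e : 'rV[R]_n.+1) :
  (\int[P]_w (expR (N * theta * (e *m X w *m e^T) 0 0))%:E =
   (\prod_(p in D) fine ('M_mu idfun (tilt e p)))%:E)%E.
Proof.
have N0 : 0 < N by rewrite ltr0n.
pose k p := N * theta * pair_mult p * (e 0 p.1 * e 0 p.2).
have mk p : measurable_fun [set: R] (fun x => expR (k p * x)).
  exact: measurable_expR_mul.
rewrite -(@integral_prod_independent R d T P _ D (fun p w => X w p.1 p.2)
  (fun p x => expR (k p * x)) (fun p => fine ('M_mu idfun (tilt e p)))).
- apply: eq_integral => w _; congr EFin; rewrite -expR_sum; congr expR.
  rewrite quadratic_formE; last exact: wigner_sym X_wigner w.
  by rewrite mulr_sumr; apply: eq_bigr => p _; rewrite /k !mulrA.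
- exact: wigner_indep X_wigner.
- by move=> p; exact: wigner_meas X_wigner p.1 p.2.
- exact: mk.
- by move=> p x; exact: expR_ge0.
move=> [i j]; rewrite inE/= => ij.
have lawE (s : R) : 0 < s -> has_law P (fun w => s * X w i j) mu ->
    k (i, j) = tilt e (i, j) * s ->
    (\int[P]_w (expR (k (i, j) * X w i j))%:E =
     (fine ('M_mu idfun (tilt e (i, j))))%:E)%E.
  move=> s0 law ks; rewrite fine_mmt_gen_funK// mmt_gen_funE.
  rewrite -(integral_has_law law (measurable_expR_mul _))//.
  by apply: eq_integral => w _; rewrite ks mulrA.
(* The scalings match: sqrt (2 N) sqrt (N / 2) = N on the diagonal and sqrt (4 N) sqrt N = 2 N above
   it. *)
move: ij; rewrite leq_eqVlt => /orP[/eqP/val_inj ij|ij].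
  subst j; apply: (lawE (Num.sqrt (N / 2))).
  - by rewrite sqrtr_gt0 divr_gt0.
  - exact: wigner_diag X_wigner i.
  rewrite /k /tilt /pair_mult/= eqxx !mulr1 [RHS]mulrAC -[theta * _ * _]mulrA.
  rewrite -sqrtrM ?mulr_ge0 ?(ltW N0)//.
  have -> : 2 * N * (N / 2) = N ^+ 2 by rewrite expr2; field.
  by rewrite sqrtr_sqr ger0_norm ?(ltW N0)// [theta * N]mulrC.
have ne_ij : i == j = false by apply/eqP => ji; move: ij; rewrite ji ltnn.
apply: (lawE (Num.sqrt N)).
- by rewrite sqrtr_gt0.
- exact: wigner_offdiag X_wigner i j ij.
rewrite /k /tilt /pair_mult/= ne_ij [RHS]mulrAC -[theta * _ * _]mulrA.
rewrite -sqrtrM ?mulr_ge0 ?(ltW N0)//.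
have -> : 2 * N * 2 * N = (2 * N) ^+ 2 by ring.
rewrite sqrtr_sqr ger0_norm ?mulr_ge0 ?(ltW N0)//.
by rewrite [N * theta]mulrC -!mulrA [N * (2 * _)]mulrCA.
Qed.

Let joint (q : T * B) : \bar R :=
  (expR (N * theta * ((q.2 : 'rV[R]_n.+1) *m X q.1 *m (q.2 : 'rV[R]_n.+1)^T) 0 0))%:E.

Let measurable_joint : measurable_fun [set: T * B] joint.
Proof.
apply/measurable_EFinP; apply: measurableT_comp => //.
apply: measurable_funM => //.
rewrite (_ : (fun q : T * B => _) = (fun q : T * B =>
    \sum_j (\sum_i (q.2 : 'rV[R]_n.+1) 0 i * X q.1 i j) * (q.2 : 'rV[R]_n.+1) 0 j)); last first.
  apply/funext => q; rewrite mxE; apply: eq_bigr => j _.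
  by rewrite !mxE.
have mc i : measurable_fun [set: T * B] (fun q : T * B => (q.2 : 'rV[R]_n.+1) 0 i).
  exact: (measurableT_comp (measurable_coord_rV i)).
have mX i j : measurable_fun [set: T * B] (fun q : T * B => X q.1 i j).
  exact: (measurableT_comp (wigner_meas X_wigner i j)).
apply: measurable_sum => j; apply: measurable_funM => //.
by apply: measurable_sum => i; exact: measurable_funM.
Qed.

Lemma annealed_laplaceE :
  (\int[P]_w \int[Q]_e
     (expR (N * theta * ((e : 'rV[R]_n.+1) *m X w *m e^T) 0 0))%:E =
   \int[Q]_e (\prod_(p in D) fine ('M_mu idfun (tilt e p)))%:E)%E.
Proof.
rewrite (fubini_tonelli joint)//; last by move=> q; rewrite lee_fin expR_ge0.
by apply: eq_integral => e _; rewrite -integral_expR_quadratic_form.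
Qed.

(** The product is a partial integral of the jointly measurable [joint], so its measurability comes
    from Tonelli. *)
Lemma measurable_prod_mmt : measurable_fun [set: B]
  (fun e : B => \prod_(p in D) fine ('M_mu idfun (tilt e p))).
Proof.
have j0 q : (0 <= joint q)%E by rewrite lee_fin expR_ge0.
have := measurable_fun_fubini_tonelli_G (m1 := P) joint measurable_joint j0.
rewrite /fubini_G /joint/= => h.
suff /measurable_EFinP : measurable_fun [set: B]
  (fun e : B => (\prod_(p in D) fine ('M_mu idfun (tilt e p)))%:E) by [].
rewrite (_ : (fun e : B => _) = (fun e : B =>
  \int[P]_w (expR (N * theta * ((e : 'rV[R]_n.+1) *m X w *m e^T) 0 0))%:E)%E)//.
by apply/funext => e; rewrite integral_expR_quadratic_form.
Qed.

End WignerLaplace.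

(** * Lower and upper bounds in fixed dimension *)

Section AnnealedBounds.
Context {R : realType} (mu : probability (measurableTypeR R) R).
Hypothesis mu_sym : symmetric_law mu.
Hypothesis mu_var : ('V_mu[idfun] = 1)%E.
Hypothesis A_lty : (subgauss_const mu < +oo)%E.
Context {n : nat} {d} {T : measurableType d} (P : probability T R).
Context (X : T -> 'M[R]_n.+1) (X_wigner : wigner mu P X) (theta : R).
Context (Q : probability (@borel_rV R n.+1) R) (Q_unif : uniform_on_sphere Q).
Hypothesis theta_ge0 : 0 <= theta.
Local Notation N := (n.+1%:R : R).
Local Notation B := (@borel_rV R n.+1).
Local Notation D := [set p : 'I_n.+1 * 'I_n.+1 | (p.1 <= p.2)%N]%SET.
Local Notation M t := (fine ('M_mu idfun t)).
Local Notation A := (fine (subgauss_const mu)).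

Let N_gt0 : 0 < N. Proof. by rewrite ltr0n. Qed.

Let mult_bound (p : 'I_n.+1 * 'I_n.+1) : 1 <= (pair_mult p : R) <= 2.
Proof. by rewrite /pair_mult; case: eqP => _; lra. Qed.

Let sqr_tilt (e : 'rV[R]_n.+1) p :
  tilt theta e p ^+ 2 = 2 * (N * theta ^+ 2) * (pair_mult p * (e 0 p.1 ^+ 2 * e 0 p.2 ^+ 2)).
Proof.
have /andP[m1 _] := mult_bound p.
rewrite /tilt !exprMn sqr_sqrtr; first by ring.
by rewrite mulr_ge0 ?(le_trans _ m1)// mulr_ge0 ?(ltW N_gt0).
Qed.

(** Computed over all ordered pairs, where the masses e_i^2 sum to 1. The lower bound takes a = 1
    and b = 0; the upper bound takes b = A - 1 and for s the indicator of large coordinates. *)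
Let sum_sqr_tilt (e : 'rV[R]_n.+1) (a b : R) (s : 'I_n.+1 -> R) :
  \sum_i e 0 i ^+ 2 = 1 ->
  \sum_(p in D) tilt theta e p ^+ 2 / 2 * (a + b * (s p.1 + s p.2)) =
  N * theta ^+ 2 * (a + 2 * b * \sum_i s i * e 0 i ^+ 2).
Proof.
move=> e1.
pose F i j := e 0 i ^+ 2 * e 0 j ^+ 2 * (a + b * (s i + s j)).
have Fsym i j : F i j = F j i by rewrite /F; ring.
transitivity (N * theta ^+ 2 * \sum_(p in D) pair_mult p * F p.1 p.2).
  by rewrite mulr_sumr; apply: eq_bigr => p _; rewrite sqr_tilt /F; field.
rewrite -sum_symmetric_pairs//; congr (_ * _).
pose S := \sum_i s i * e 0 i ^+ 2.
transitivity (\sum_i ((a + b * s i) * e 0 i ^+ 2 + b * S * e 0 i ^+ 2)).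
  apply: eq_bigr => i _.
  transitivity (\sum_j ((a + b * s i) * e 0 i ^+ 2 * e 0 j ^+ 2 +
                        b * e 0 i ^+ 2 * (s j * e 0 j ^+ 2))).
    by apply: eq_bigr => j _; rewrite /F; ring.
  by rewrite big_split/= -!mulr_sumr e1 -/S; ring.
rewrite big_split/= -mulr_sumr e1.
under eq_bigr do rewrite mulrDl.
rewrite big_split/= -mulr_sumr e1.
under eq_bigr do rewrite -mulrA.
by rewrite -mulr_sumr -/S; ring.
Qed.

(** The quadratic terms add up exactly to N theta^2. In the quartic ones, m^2 <= 2 m for a
    multiplicity m <= 2 leaves 2 N^2 theta^4 times the square of the sum of the e_i^4. *)
Lemma prod_mmt_ge (e : 'rV[R]_n.+1) : \sum_i e 0 i ^+ 2 = 1 ->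
  expR (N * theta ^+ 2 - 2 * N ^+ 2 * theta ^+ 4 * \sum_i e 0 i ^+ 6) <=
  \prod_(p in D) M (tilt theta e p).
Proof.
move=> e1.
apply: (@le_trans _ _ (\prod_(p in D)
    expR (tilt theta e p ^+ 2 / 2 - tilt theta e p ^+ 4 / 4))); last first.
  by apply: ler_prod => p _; rewrite expR_ge0 fine_mmt_gen_fun_ge.
rewrite -expR_sum ler_expR sumrB; apply: lerB.
  have := @sum_sqr_tilt e 1 0 (fun=> 0) e1.
  under eq_bigr do rewrite mul0r addr0 mulr1.
  by move=> ->; rewrite mulr0 mul0r addr0 mulr1.
pose m := \sum_i e 0 i ^+ 4.
apply: (@le_trans _ _ (2 * N ^+ 2 * theta ^+ 4 * m ^+ 2)); last first.
  apply: ler_wpM2l; first by rewrite mulr_ge0 ?exprn_ge0// mulr_ge0 ?exprn_ge0.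
  (* Nonnegativity of the variance of e_i^2 under the probability weights e_i^2, that is, m^2 <=
     sum_i e_i^6. *)
  have : 0 <= \sum_i e 0 i ^+ 2 * (e 0 i ^+ 2 - m) ^+ 2.
    by apply: sumr_ge0 => i _; rewrite mulr_ge0 ?sqr_ge0.
  have -> : \sum_i e 0 i ^+ 2 * (e 0 i ^+ 2 - m) ^+ 2 =
      \sum_i (e 0 i ^+ 6 + (- (2 * m)) * e 0 i ^+ 4 + m ^+ 2 * e 0 i ^+ 2).
    by apply: eq_bigr => i _; ring.
  by rewrite !big_split/= -!mulr_sumr e1 -/m; lra.
have -> : m ^+ 2 = \sum_i \sum_j e 0 i ^+ 4 * e 0 j ^+ 4.
  by rewrite expr2 /m mulr_suml; apply: eq_bigr => i _; rewrite mulr_sumr.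
rewrite (@sum_symmetric_pairs _ _ (fun i j => e 0 i ^+ 4 * e 0 j ^+ 4)); last first.
  by move=> i j; rewrite mulrC.
rewrite mulr_sumr; apply: ler_sum => p _.
have -> : tilt theta e p ^+ 4 / 4 = N ^+ 2 * theta ^+ 4 * pair_mult p ^+ 2 *
    (e 0 p.1 ^+ 4 * e 0 p.2 ^+ 4).
  have -> : tilt theta e p ^+ 4 = (tilt theta e p ^+ 2) ^+ 2 by rewrite -exprM.
  by rewrite sqr_tilt; field.
have -> : 2 * N ^+ 2 * theta ^+ 4 * (pair_mult p * (e 0 p.1 ^+ 4 * e 0 p.2 ^+ 4)) =
    N ^+ 2 * theta ^+ 4 * (2 * pair_mult p) * (e 0 p.1 ^+ 4 * e 0 p.2 ^+ 4) by ring.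
apply: ler_wpM2r; first by rewrite mulr_ge0 ?exprn_even_ge0.
apply: ler_wpM2l; first by rewrite mulr_ge0 ?exprn_ge0.
by have /andP[m1 m2] := mult_bound p; rewrite expr2 ler_wpM2r// (le_trans _ m1).
Qed.

Lemma annealed_laplace_ge (C : R) : 0 <= C ->
  (forall y, 0 <= y -> y ^+ 6 <= C * expR y) ->
  ((expR (N * theta ^+ 2 - 4 * theta ^+ 4 * C * expR 2^-1))%:E <=
   \int[Q]_e (\prod_(p in D) M (tilt theta e p))%:E)%E.
Proof.
(* [c] is the coefficient 2 N^2 theta^4 of [prod_mmt_ge] times the bound of [integral_sum_expo6_le];
   the powers of N cancel. *)
move=> C0 C6; set c := 4 * theta ^+ 4 * C * expR 2^-1.
set E := expR (_ - c); set I := (\int[Q]_e _)%E.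
pose k := 2 * N ^+ 2 * theta ^+ 4.
have k0 : 0 <= k by rewrite mulr_ge0 ?exprn_ge0// mulr_ge0 ?exprn_ge0.
have E0 : 0 <= E by exact: expR_ge0.
have c0 : 0 <= c by rewrite mulr_ge0 ?expR_ge0// mulr_ge0// mulr_ge0// exprn_ge0.
have mX : measurable_fun [set: B] (fun e : B => \sum_i (e : 'rV[R]_n.+1) 0 i ^+ 6).
  by apply: measurable_sum => i; apply: measurable_funX; exact: measurable_coord_rV.
have X0 (e : B) : 0 <= \sum_i (e : 'rV[R]_n.+1) 0 i ^+ 6.
  by apply: sumr_ge0 => i _; rewrite exprn_even_ge0.
have mM := measurable_prod_mmt mu_sym A_lty X_wigner theta.
have M0 (e : B) : 0 <= \prod_(p in D) M (tilt theta e p).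
  by apply: prodr_ge0 => p _; rewrite fine_ge0// (le_trans _ (mmt_gen_fun_ge1 mu_sym _)).
(* [exp (- Y) >= exp (- c) (1 + c - Y)], with [Y] moved to the other side to keep
   both integrands nonnegative. *)
have : ((E * (1 + c))%:E <= \int[Q]_e (\prod_(p in D) M (tilt theta e p) +
    E * k * \sum_i (e : 'rV[R]_n.+1) 0 i ^+ 6)%:E)%E.
  have -> : ((E * (1 + c))%:E = \int[Q]_e (E * (1 + c))%:E)%E.
    by rewrite integral_cst// [X in (_ * X)%E]probability_setT mule1.
  apply: (@le_integral_sphere _ _ _ Q_unif (fun=> E * (1 + c)) (fun e : B =>
    \prod_(p in D) M (tilt theta e p) + E * k * \sum_i (e : 'rV[R]_n.+1) 0 i ^+ 6)) => //.
  - by apply: measurable_funD => //; exact: measurable_funM.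
  - by move=> e; rewrite mulr_ge0 ?addr_ge0.
  - by move=> e; rewrite addr_ge0 ?mulr_ge0 ?M0 ?X0.
  move=> e e1; have := prod_mmt_ge e1; rewrite -/k.
  set Y := \sum_i _; set W := \prod_(p in D) _ => WY.
  have : E * (1 + (c - k * Y)) <= W.
    apply: le_trans WY; rewrite /E.
    have -> : N * theta ^+ 2 - k * Y = (N * theta ^+ 2 - c) + (c - k * Y) by ring.
    by rewrite [leRHS]expRD ler_wpM2l ?expR_ge0// expR_ge1Dx.
  by move=> h; lra.
under [X in (_ <= X)%E -> _]eq_integral do rewrite EFinD EFinM.
have mX' := measurable_EFin_rV mX; have mM' := measurable_EFin_rV mM.
rewrite ge0_integralD//=; last 3 first.
- by move=> e _; rewrite lee_fin M0.
- by move=> e _; rewrite -EFinM lee_fin mulr_ge0 ?mulr_ge0 ?X0.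
- exact: emeasurable_funM.
rewrite ge0_integralZl//=; last 2 first.
- by move=> e _; rewrite lee_fin X0.
- by rewrite lee_fin mulr_ge0.
move=> h; have : ((E * (1 + c))%:E <= I + (E * c)%:E)%E.
  apply: (le_trans h); apply: leeD => //.
  apply: (@le_trans _ _ ((E * k)%:E * (2 * C * expR 2^-1 / N ^+ 2)%:E)%E).
    apply: lee_wpmul2l; first by rewrite lee_fin mulr_ge0.
    exact: integral_sum_expo6_le.
  rewrite -EFinM; suff -> : (E * k * (2 * C * expR 2^-1 / N ^+ 2) = E * c)%R by [].
  by rewrite /k /c; field; rewrite gt_eqF.
by rewrite mulrDr mulr1 EFinD leeD2rE.
Qed.

Hypothesis A_gt1 : 1 < A.
Hypothesis theta_le : theta <= (2 * Num.sqrt (A - 1))^-1.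

(** The threshold on [theta], squared: it brings 2 N theta^2 (A - 1) down to at most N / 2, the
    exponent handled by [integral_expR_large_le]. *)
Let sqr_theta_le : 4 * (theta ^+ 2 * (A - 1)) <= 1.
Proof.
have A1 : 0 < A - 1 by rewrite subr_gt0.
have s0 : 0 < 2 * Num.sqrt (A - 1) by rewrite mulr_gt0// sqrtr_gt0.
move: theta_le; rewrite -[X in _ <= X]mul1r ler_pdivlMr// => h.
have : (theta * (2 * Num.sqrt (A - 1))) ^+ 2 <= 1.
  by rewrite expr_le1// mulr_ge0// ltW.
rewrite !exprMn sqr_sqrtr ?(ltW A1)//.
by move=> h2; lra.
Qed.

Lemma annealed_laplace_le (K eta t : R) : 0 <= K -> 0 < eta -> eta <= 1 ->
  (forall x, `|x| <= 1 -> M x <= expR ((1 + K * `|x|) / 2 * x ^+ 2)) ->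
  0 < t -> 2 * theta * Num.sqrt N * t <= eta ->
  (\int[Q]_e (\prod_(p in D) M (tilt theta e p))%:E <=
   (expR (N * theta ^+ 2 * (1 + K * eta) + ((2^-1 + 2 * ln N) / t + 4)))%:E)%E.
Proof.
move=> K0 eta0 eta1 MK t0 t_eta.
pose big (e : 'rV[R]_n.+1) i : R := (t < e 0 i ^+ 2)%R%:R.
have mM := measurable_prod_mmt mu_sym A_lty X_wigner theta.
have M0 x : 0 <= M x by rewrite fine_ge0// (le_trans _ (mmt_gen_fun_ge1 mu_sym _)).
have mL := measurable_large_mass t.
apply: (@le_trans _ _ (\int[Q]_e (expR (N * theta ^+ 2 * (1 + K * eta)) *
  expR (N / 2 * \sum_i (t < (e : 'rV[R]_n.+1) 0 i ^+ 2)%R%:R * (e : 'rV[R]_n.+1) 0 i ^+ 2))%:E)%E);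
  last first.
  have mE : measurable_fun [set: B] (fun e : B =>
      expR (N / 2 * \sum_i (t < (e : 'rV[R]_n.+1) 0 i ^+ 2)%R%:R * (e : 'rV[R]_n.+1) 0 i ^+ 2)).
    by apply: measurableT_comp => //; exact: measurable_funM.
  under eq_integral do rewrite EFinM.
  rewrite ge0_integralZl//=; last exact: (measurable_EFin_rV mE).
  rewrite expRD EFinM; apply: lee_wpmul2l; first by rewrite lee_fin expR_ge0.
  exact: integral_expR_large_le.
apply: (le_integral_sphere Q_unif) => //.
- apply: measurable_funM => //; apply: measurableT_comp => //.
  exact: measurable_funM.
- by move=> e; apply: prodr_ge0.
move=> e e1; rewrite -expRD.
apply: (@le_trans _ _ (\prod_(p in D) expR (tilt theta e p ^+ 2 / 2 *
    ((1 + K * eta) + (A - 1) * (big e p.1 + big e p.2))))).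
  apply: ler_prod => p _; rewrite M0/=.
  have t2 : 0 <= tilt theta e p ^+ 2 / 2 by rewrite divr_ge0 ?sqr_ge0.
  have [small|large] := boolP ((e 0 p.1 ^+ 2 <= t) && (e 0 p.2 ^+ 2 <= t)).
    have /andP[s1 s2] := small.
    rewrite /big !ltNge s1 s2 /= addr0 mulr0 addr0.
    (* Two small coordinates give |e_i e_j| <= t, and the multiplicity is at most 2, so the tilt is
       at most 2 theta sqrt N t. *)
    have te : `|tilt theta e p| <= eta.
      rewrite -(@ler_pXn2r _ 2)// ?nnegrE ?(ltW eta0)//.
      rewrite real_normK ?num_real// sqr_tilt.
      apply: (@le_trans _ _ ((2 * theta * Num.sqrt N * t) ^+ 2)); last first.
        by rewrite ler_pXn2r// ?nnegrE ?(ltW eta0)// !mulr_ge0 ?sqrtr_ge0// ltW.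
      rewrite !exprMn sqr_sqrtr ?(ltW N_gt0)//.
      have -> : 2 ^+ 2 * theta ^+ 2 * N * t ^+ 2 =
        2 * (N * theta ^+ 2) * (2 * (t * t)) by ring.
      apply: ler_wpM2l; first by rewrite mulr_ge0// mulr_ge0 ?sqr_ge0.
      have /andP[m1 m2] := mult_bound p.
      apply: ler_pM => //; first exact: (le_trans _ m1).
        by rewrite mulr_ge0 ?sqr_ge0.
      by apply: ler_pM; rewrite ?sqr_ge0.
    apply: (le_trans (MK _ (le_trans te eta1))); rewrite ler_expR.
    have -> : (1 + K * `|tilt theta e p|) / 2 * tilt theta e p ^+ 2 =
      tilt theta e p ^+ 2 / 2 * (1 + K * `|tilt theta e p|) by ring.
    by apply: ler_wpM2l => //; rewrite lerD2l ler_wpM2l.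
  apply: (le_trans (fine_mmt_gen_fun_le mu_sym A_lty _)); rewrite ler_expR.
  have -> : A / 2 * tilt theta e p ^+ 2 = tilt theta e p ^+ 2 / 2 * A by field.
  apply: ler_wpM2l => //.
  (* One index at least is large, so A <= 1 + (A - 1) (big + big): the global bound fits the common
     form. *)
  have big1 : 1 <= big e p.1 + big e p.2.
    move: large; rewrite negb_and -!ltNge /big.
    by case: ltP => _; case: ltP => _ //= _; rewrite ?addr0 ?add0r ?lerDl ?ler01.
  have : (A - 1) * 1 <= (A - 1) * (big e p.1 + big e p.2).
    by rewrite ler_wpM2l// subr_ge0 ltW.
  have : 0 <= K * eta by rewrite mulr_ge0// ltW.
  by lra.
rewrite -expR_sum ler_expR sum_sqr_tilt// mulrDr lerD2l /big.
set s := \sum_i _.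
have s0 : 0 <= s by apply: sumr_ge0 => i _; rewrite mulr_ge0 ?sqr_ge0.
have -> : N * theta ^+ 2 * (2 * (A - 1) * s) = (4 * (theta ^+ 2 * (A - 1))) * (N / 2 * s).
  by field.
by rewrite ler_piMl// mulr_ge0// divr_ge0// ltW.
Qed.

End AnnealedBounds.

(** * Choice of the parameters and passage to the limit *)

Lemma lne_squeeze (R : realType) (a b : R) (x : \bar R) :
  ((expR a)%:E <= x)%E -> (x <= (expR b)%:E)%E -> (a%:E <= lne x <= b%:E)%E.
Proof.
move=> ax xb.
have x0 : (0 <= x)%E by rewrite (le_trans _ ax)// lee_fin expR_ge0.
rewrite -[a%:E]expeRK -[b%:E]expeRK !lee_lne ?in_itv/= ?leey ?andbT ?lee_fin ?expR_ge0//.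
by rewrite ax xb.
Qed.

Lemma sqrt_ge1 (R : rcfType) (x : R) : 1 <= x -> 1 <= Num.sqrt x.
Proof.
move=> x1; have x0 := lt_le_trans ltr01 x1.
by rewrite -[leLHS]sqrtr1 ler_sqrt// ltW.
Qed.

(** With q = N^(1/8), sqrt N = q^4 and ln N <= 8 q, so all rates become integer powers of q. *)
Definition root8 {R : realType} (x : R) : R := Num.sqrt (Num.sqrt (Num.sqrt x)).

Lemma root8K (R : realType) (x : R) : 0 <= x -> root8 x ^+ 8 = x.
Proof.
move=> x0; have -> : root8 x ^+ 8 = ((root8 x ^+ 2) ^+ 2) ^+ 2 by rewrite -!exprM.
by rewrite /root8 !sqr_sqrtr ?sqrtr_ge0.
Qed.

Lemma cvg_root8V (R : realType) : (root8 (n.+1%:R : R))^-1 @[n --> \oo] --> (0 : R).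
Proof.
have -> : (fun n => (root8 (n.+1%:R : R))^-1) = (fun n => root8 (harmonic n)).
  by apply/funext => n; rewrite /root8 /harmonic/= !sqrtrV ?sqrtr_ge0.
have r0 : root8 0 = 0 :> R by rewrite /root8 !sqrtr0.
rewrite -[X in _ --> X]r0.
by do 3 (apply: (continuous_cvg _ (@sqrt_continuous R _))); exact: cvg_harmonic.
Qed.

Theorem lemma2 (R : realType) (mu : probability (measurableTypeR R) R)
    (mu_sym : symmetric_law mu)
    (mu_var : ('V_mu[idfun] = 1)%E)
    (A_lty : (subgauss_const mu < +oo)%E)
    (A_gt1 : (1 < subgauss_const mu)%E)
    (B_lim : exists2 B : R, 0 <= B &
      (2%:E * psi mu x)%E @[x --> +oo] --> B%:E /\
      (2%:E * psi mu x)%E @[x --> -oo] --> B%:E)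
    (L_lip : [lipschitz fine (logmgf mu (Num.sqrt x)) | x in `[0, +oo[])
    (disp : nat -> measure_display)
    (T : forall n, measurableType (disp n))
    (P : forall n, probability (T n) R)
    (X : forall n, T n -> 'M[R]_n.+1)
    (X_wigner : forall n, wigner mu (P n) (X n))
    (dist : probability (measurableTypeR R) R ->
            probability (measurableTypeR R) R -> R)
    (dist_weak : weakly_compatible_distance dist)
    (X_conc : exists2 kappa : R, 0 < kappa &
      limn_esup (fun n => (n.+1%:R^-1)%:E * lne (P n
        [set w | (n.+1%:R `^ (- kappa) < dist (esd (X n w)) semicircle)%R]))%E
      = -oo%E)
    (Q : forall n, probability (borel_rV n.+1) R)
    (Q_unif : forall n, uniform_on_sphere (Q n))
    (theta : R)
    (theta_ge0 : 0 <= theta)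
    (theta_le : theta <= (2 * Num.sqrt (fine (subgauss_const mu) - 1))^-1) :
  limn_einf (fun n => annealed_F (P n) (X n) (Q n) theta) = (theta ^+ 2)%:E /\
  limn_esup (fun n => annealed_F (P n) (X n) (Q n) theta) = (theta ^+ 2)%:E.
Proof.
have Afin : (fine (subgauss_const mu))%:E = subgauss_const mu.
  by apply: fineK; rewrite fin_numE gt_eqF ?lt_eqF// (lt_trans _ A_gt1)// ltNyr.
have A1 : 1 < fine (subgauss_const mu) by rewrite -lte_fin Afin.
have [C C0 C6] := expo6_le_expR R.
have [K K0 MK] := fine_mmt_gen_fun_le_near0 mu_sym mu_var A_lty.
pose c := 4 * theta ^+ 4 * C * expR 2^-1.
have c0 : 0 <= c by rewrite mulr_ge0 ?expR_ge0// mulr_ge0// mulr_ge0// exprn_ge0.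
(* Three errors, each a multiple of 1 / q: [theta ^+ 2 * K * eta] from small pairs, the cost of the
   large coordinates, and the additive 4 in the exponent. *)
pose c' := theta ^+ 2 * K + 17 * (2 * theta + 1) + 4.
pose q n : R := root8 n.+1%:R.
have F_bounds n : ((theta ^+ 2 - c / q n)%:E <= annealed_F (P n) (X n) (Q n) theta
    <= (theta ^+ 2 + c' / q n)%:E)%E.
  have N0 : 0 < n.+1%:R :> R by rewrite ltr0n.
  have q1 : 1 <= q n by rewrite /q /root8 !sqrt_ge1// ler1n.
  have qN : n.+1%:R = q n ^+ 8 by rewrite /q root8K// ltW.
  have sqN : Num.sqrt n.+1%:R = q n ^+ 4.
    by rewrite /q /root8 (exprM _ 2 2) !sqr_sqrtr ?sqrtr_ge0.
  have q0 := lt_le_trans ltr01 q1.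
  (* Dividing by 2 theta + 1 rather than by 2 theta keeps the cutoff meaningful at theta = 0. *)
  have th1 : 0 < 2 * theta + 1 by rewrite ltr_wpDl// mulr_ge0.
  have lower := annealed_laplace_ge mu_sym mu_var A_lty (X_wigner n) (Q_unif n) theta_ge0 C0 C6.
  (* Coordinates below [t] have mutual tilts at most [eta], while [ln N / t] is
     still [O(N / q n)]. *)
  pose eta := (q n)^-1; pose t := eta / ((2 * theta + 1) * q n ^+ 4).
  have eta0 : 0 < eta by rewrite invr_gt0.
  have eta1 : eta <= 1 by rewrite invf_le1.
  have t0 : 0 < t by rewrite divr_gt0// mulr_gt0// exprn_gt0.
  have t_eta : 2 * theta * Num.sqrt n.+1%:R * t <= eta.
    rewrite sqN /t mulrCA -[leRHS]mulr1 ler_wpM2l ?(ltW eta0)//.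
    rewrite ler_pdivrMr ?mulr_gt0 ?exprn_gt0// mul1r ler_wpM2r ?exprn_ge0 ?(ltW q0)//.
    by rewrite lerDl.
  have upper := annealed_laplace_le mu_sym A_lty (X_wigner n) (Q_unif n) theta_ge0 A1 theta_le
    K0 eta0 eta1 MK t0 t_eta.
  have /andP[lo hi] := lne_squeeze lower upper.
  have N0' : (0 <= (n.+1%:R^-1)%:E :> \bar R)%E by rewrite lee_fin invr_ge0 ltW.
  rewrite /annealed_F (annealed_laplaceE mu_sym A_lty (X_wigner n)); apply/andP; split.
    apply: le_trans (lee_wpmul2l N0' lo); rewrite -EFinM lee_fin -/c mulrBr.
    rewrite mulrA mulVf ?gt_eqF// mul1r lerD2l lerN2 mulrC ler_wpM2l//.
    by rewrite lef_pV2 ?posrE// qN ler_eXnr.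
  apply: (le_trans (lee_wpmul2l N0' hi)); rewrite -EFinM lee_fin.
  have lnN : ln n.+1%:R <= 8 * q n.
    rewrite qN lnXn// -[leLHS]mulr_natl ler_wpM2l// ltW// ln_sublinear//.
  rewrite mulrDr !mulrA mulVf ?gt_eqF// mul1r mulrDr mulr1 -addrA lerD2l.
  have -> : c' / q n = theta ^+ 2 * K * eta + (17 * (2 * theta + 1) / q n + 4 / q n).
    by rewrite /c' /eta; field; rewrite gt_eqF.
  rewrite mulrA lerD2l mulrDr; apply: lerD; last first.
    by rewrite mulrC ler_wpM2l// lef_pV2 ?posrE// qN ler_eXnr.
  rewrite mulrC ler_pdivrMr// qN.
  (* The 17 comes from 1/2 + 2 ln N <= 1/2 + 16 q <= 17 q^2, as q >= 1. *)
  have -> : 17 * (2 * theta + 1) / q n * q n ^+ 8 = 17 * q n ^+ 2 / t.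
    by rewrite /t /eta; field; rewrite !gt_eqF.
  have qq : q n <= q n ^+ 2 by rewrite ler_eXnr.
  by rewrite ler_wpM2r ?invr_ge0 ?(ltW t0)// -qN; lra.
have Vq := @cvg_root8V R.
suff F_cvg : annealed_F (P n) (X n) (Q n) theta @[n --> \oo] --> (theta ^+ 2)%:E.
  by split; rewrite (cvg_limn_einf_sup F_cvg).
have cvg_side (k : R) : (theta ^+ 2 + k * (q n)^-1)%:E @[n --> \oo] --> (theta ^+ 2)%:E.
  apply: cvg_EFin; first exact: nearW.
  rewrite -[X in _ --> X]addr0 -[X in _ + X](mulr0 k).
  by apply: cvgD; [exact: cvg_cst|apply: cvgM; [exact: cvg_cst|exact: Vq]].
apply: (squeeze_cvge _ (cvg_side (- c)) (cvg_side c')).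
by apply: nearW => n; rewrite mulNr F_bounds.
Qed.
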